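(* Let $\mathbb{F}$ be a field of characteristic $2$ and let $L$ be a nilpotent symplectic alternating algebra over $\mathbb{F}$ of dimension $10$ that has an isotropic centre of dimension $3$. Suppose also that $L$ has the further properties that $\dim L^{3}=6$, $L^{3}L^{2}=L^{5}$ and $L$ is of type C where the minimal polynomial $m(y_{2},y_{3})$ is irreducible with a non-zero linear term. Then $L$ has a presentation of the form $$\mathcal{P}_{10}^{(3,9)}(\gamma,r,s):\ (x_{2}y_{4},y_{5})=\gamma,\ (x_{1}y_{3},y_{4})=r,\ (x_{1}y_{3},y_{5})=s,\ (x_{1}y_{2},y_{4})=1,\ (y_{1}y_{2},y_{5})=1,\ (y_{1}y_{3},y_{4})=1$$ where $\gamma,r,s\in\mathbb{F}$, $\gamma,r\neq 0$ and $t^{2}+rt+s$ is irreducible in $\mathbb{F}[t]$. Furthermore, for two such triples of parameters $(\gamma,r,s)$ and $(\tilde\gamma,\tilde r,\tilde s)$ (that is, with $\gamma,r,\tilde\gamma,\tilde r\ne 0$ and $t^2+rt+s$, $t^2+\tilde rt+\tilde s$ irreducible), the presentations $\mathcal{P}_{10}^{(3,9)}(\tilde\gamma,\tilde r,\tilde s)$ and $\mathcal{P}_{10}^{(3,9)}(\gamma,r,s)$ describe the same algebra (up to isomorphism) if and only if $$\frac{\tilde\gamma}{\gamma}\in(\mathbb{F}^{*})^{3},\qquad \frac{\tilde r}{r}\in G(r,s)\qquad\text{and}\qquad \tilde s-\Big(\frac{\tilde r}{r}\Big)^{2}s\in H(\tilde r).$$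
   Context: A symplectic alternating algebra (SAA) over a field $\mathbb{F}$ is a finite-dimensional $\mathbb{F}$-vector space $L$ with a non-degenerate alternating bilinear form $(\ ,\ )$ and a bilinear alternating product $L\times L\to L$, $(x,y)\mapsto xy$ (so $xx=0$), such that $(xy,z)=(yz,x)$ for all $x,y,z\in L$. It follows that $(x,y,z)\mapsto (xy,z)$ is an alternating trilinear form. Isomorphisms of SAAs are linear bijections preserving the form and the product. For subspaces $A,B$, $AB$ denotes the linear span of all products $ab$ with $a\in A,b\in B$. The lower central series is $L^1=L$, $L^{k+1}=L^k L$; the upper central series is $Z_0(L)=0$, $Z_{k+1}(L)=\{x\in L: xL\leq Z_k(L)\}$, with $Z(L)=Z_1(L)$ the centre. $L$ is nilpotent if $L^{k}=0$ for some $k$. A subspace is isotropic if the form vanishes identically on it. A standard basis of a $10$-dimensional SAA is a basis $x_1,y_1,\ldots,x_5,y_5$ with $(x_i,x_j)=(y_i,y_j)=0$ and $(x_i,y_j)=\delta_{ij}$ for all $i,j$. A presentation lists values of triples $(uv,w)$ with $u,v,w$ distinct elements of a standard basis; the convention is that all triple values of basis elements not listed (and not determined from the listed ones by the alternating property) are $0$. Such data determine the product, hence the SAA, uniquely. $\mathbb{F}^{*}=\mathbb{F}\setminus\{0\}$ and $(\mathbb{F}^{*})^{3}=\{b^3: b\in\mathbb{F}^{*}\}$. For an irreducible polynomial $t^2+rt+s\in\mathbb{F}[t]$ put $$H(r)=\{x^{2}+rx:\ x\in\mathbb{F}\},\qquad G(r,s)=\{x^{2}+rxy+sy^{2}:\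 (x,y)\in\mathbb{F}\times\mathbb{F}\setminus\{(0,0)\}\}.$$ Types. Let $L$ be a nilpotent SAA of dimension $10$ with isotropic centre of dimension $3$, $\dim L^3=6$ and $L^3L^2=L^5$. Then one can choose a standard basis adapted to the central series in the sense that $L^{5}=\mathbb{F}x_{5}+\mathbb{F}x_{4}$, $Z(L)=L^5+\mathbb{F}x_{3}$, $Z_{2}(L)=L^{4}=Z(L)+\mathbb{F}x_{2}$, $Z_{3}(L)=L^{3}=L^4+\mathbb{F}x_{1}+\mathbb{F}y_{1}$, $L^{2}=L^{3}+\mathbb{F}y_{2}$, $Z_{4}(L)=L^{3}+\mathbb{F}y_{2}+\mathbb{F}y_{3}$. Since $L^4Z_4(L)=0$, the linear maps $\phi,\psi: L^{3}/L^{4}\to L^{5}$, $\phi(u+L^4)=uy_2$, $\psi(u+L^4)=uy_3$, are well defined; $\phi$ is bijective because $L^3L^2=L^5$. Put $\tau=\psi\phi^{-1}:L^5\to L^5$ and let $m(y_2,y_3)$ denote its minimal polynomial. It has degree $2$, and exactly one of the following holds, independently of the choice of adapted standard basis: type A: $m(y_2,y_3)$ has two distinct roots in $\mathbb{F}$; type B: it has a double root in $\mathbb{F}$; type C: it is irreducible in $\mathbb{F}[t]$. In characteristic $2$, whether $m(y_2,y_3)$ has zero or non-zero linear term is also independent of the choice of adapted standard basis. *)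

(* Defs.v *)
From HB Require Import structures.
From mathcomp Require Import all_boot all_order all_algebra.
From mathcomp Require Import ring zify.

Set Implicit Arguments.
Unset Strict Implicit.
Unset Printing Implicit Defensive.

Import GRing.Theory.
Local Open Scope ring_scope.

Record saa (F : fieldType) := SAA {
  saa_sort :> vectType F;
  saa_form : {biscalar saa_sort};
  saa_mul : {bilinear saa_sort -> saa_sort -> saa_sort};
  saa_formxx : forall x, saa_form x x = 0;
  saa_form_nondegenerate : forall x, (forall y, saa_form x y = 0) -> x = 0;
  saa_mulxx : forall x, saa_mul x x = 0;
  saa_form_mul_cycle : forall x y z, 
    saa_form (saa_mul x y) z = saa_form (saa_mul y z) x
}.

Arguments saa_form {F s}.
Arguments saa_mul {F s}.

Section Theory.
Variables (F : fieldType) (L : saa F).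
Implicit Types (U V W : {vspace L}).

(* Spanned by products of basis vectors, as falgebra's prodv; by bilinearity
   this is the span of all the products (see [saa_prodP]). *)
Definition saa_prod U V : {vspace L} :=
  <<allpairs (fun a b : L => saa_mul a b) (vbasis U) (vbasis V)>>%VS.

Lemma mem_saa_prod U V u v : u \in U -> v \in V -> saa_mul u v \in saa_prod U V.
Proof.
move=> /coord_vbasis-> /coord_vbasis->.
rewrite linear_sumlz memv_suml // => i _; rewrite linear_sumr memv_suml // => j _.
rewrite linearZl_LR linearZr_LR /= !memvZ // memv_span //.
by apply: allpairs_f; rewrite memt_nth.
Qed.

Lemma saa_prodP U V W :
  reflect {in U & V, forall u v, saa_mul u v \in W} (saa_prod U V <= W)%VS.
Proof.
apply: (iffP idP) => [sUVW u v Uu Vv | sUVW].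
  by rewrite (subvP sUVW) ?mem_saa_prod.
apply/span_subvP=> _ /allpairsP[[u v] /= [Uu Vv ->]].
by rewrite sUVW ?vbasis_mem.
Qed.

(* [lcs k] is $L^k$, so [lcs 1] is the whole algebra (and so is the unused
   [lcs 0]). *)
Definition lcs (k : nat) : {vspace L} :=
  iter k.-1 (fun U => saa_prod U fullv) fullv.

Definition nilpotent : Prop := exists k, lcs k = 0%VS.

Definition saa_mulr (y : L) : 'End(L) := linfun (fun x => saa_mul x y).

Definition ucs_step U : {vspace L} :=
  (\bigcap_(y <- vbasis (fullv : {vspace L})) (saa_mulr y @^-1: U))%VS.

Fixpoint ucs (k : nat) : {vspace L} :=
  if k is k'.+1 then ucs_step (ucs k') else 0%VS.

Definition saa_center : {vspace L} := ucs 1.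

Lemma saa_mulrE y x : saa_mulr y x = saa_mul x y.
Proof.
have lin : linear (fun x => saa_mul x y) by move=> a u v; rewrite linearPl.
pose g := GRing.isLinear.Build F L L *:%R (fun x => saa_mul x y) lin.
by rewrite (lfunE (HB.pack_for {linear L -> L} (fun x => saa_mul x y) g)).
Qed.

Lemma mem_ucsS k x :
  reflect (forall y, saa_mul x y \in ucs k) (x \in ucs k.+1).
Proof.
rewrite /= /ucs_step; apply: (iffP idP) => [xk y | xk].
  have xe e : e \in vbasis (fullv : {vspace L}) -> saa_mul x e \in ucs k.
    move=> /(nthP 0)[i]; rewrite size_tuple => ltid <-.
    by move: xk; rewrite big_tuple => /subv_bigcapP/(_ (Ordinal ltid) isT);
      rewrite -saa_mulrE memv_preim (tnth_nth 0).
  rewrite (coord_vbasis (memvf y)) linear_sumr memv_suml // => i _.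
  by rewrite linearZr_LR /= memvZ // xe // memt_nth.
rewrite memvE big_tuple; apply/subv_bigcapP => i _.
by rewrite -memvE -memv_preim saa_mulrE.
Qed.

Definition isotropic U : Prop := {in U &, forall u v, saa_form u v = 0}.

End Theory.

Arguments lcs {F} L k.
Arguments ucs {F} L k.
Arguments saa_center {F} L.
Arguments nilpotent {F} L.

Definition saa_iso (F : fieldType) (L M : saa F) : Prop :=
  exists f : 'Hom(L, M),
    [/\ bijective f,
        forall u v, saa_form (f u) (f v) = saa_form u v &
        forall u v, f (saa_mul u v) = saa_mul (f u) (f v)].

(* Names of the elements of a standard basis of a 10-dimensional algebra:
   [x_ k] and [y_ k] for 1 <= k <= 5. *)
Definition gen : finType := ('I_5 + 'I_5)%type.
Definition x_ (k : nat) : gen := inl (inord k.-1).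
Definition y_ (k : nat) : gen := inr (inord k.-1).

Definition standard_basis (F : fieldType) (L : saa F) (b : gen -> L) : Prop :=
  [/\ basis_of fullv (codom b),
      forall i j, saa_form (b (inl i)) (b (inl j)) = 0,
      forall i j, saa_form (b (inr i)) (b (inr j)) = 0 &
      forall i j, saa_form (b (inl i)) (b (inr j)) = (i == j)%:R].

(* The entry (u, v, w, c) stands for (uv, w) = c. *)
Definition presentation (F : fieldType) := seq (gen * gen * gen * F).

Definition has_presentation (F : fieldType) (L : saa F)
    (P : presentation F) : Prop :=
  exists b : gen -> L,
    [/\ standard_basis b,
        forall u v w c, (u, v, w, c) \in P ->
          saa_form (saa_mul (b u) (b v)) (b w) = c &
        forall u v w,
          (forall u' v' w' c, (u', v', w', c) \in P ->
             ~~ perm_eq [:: u; v; w] [:: u'; v'; w']) ->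
          saa_form (saa_mul (b u) (b v)) (b w) = 0].

Definition P10_3_9 (F : fieldType) (gamma r s : F) : presentation F :=
  [:: (x_ 2, y_ 4, y_ 5, gamma);
      (x_ 1, y_ 3, y_ 4, r);
      (x_ 1, y_ 3, y_ 5, s);
      (x_ 1, y_ 2, y_ 4, 1);
      (y_ 1, y_ 2, y_ 5, 1);
      (y_ 1, y_ 3, y_ 4, 1)].

Section AdaptedBasis.
Variables (F : fieldType) (L : saa F) (b : gen -> L).

Definition adapted_basis : Prop :=
  [/\ standard_basis b,
      lcs L 5 = (<[b (x_ 5)]> + <[b (x_ 4)]>)%VS /\
      saa_center L = (lcs L 5 + <[b (x_ 3)]>)%VS,
      ucs L 2 = lcs L 4 /\ lcs L 4 = (saa_center L + <[b (x_ 2)]>)%VS,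
      ucs L 3 = lcs L 3 /\
      lcs L 3 = (lcs L 4 + <[b (x_ 1)]> + <[b (y_ 1)]>)%VS &
      lcs L 2 = (lcs L 3 + <[b (y_ 2)]>)%VS /\
      ucs L 4 = (lcs L 3 + <[b (y_ 2)]> + <[b (y_ 3)]>)%VS].

(* [phi] and [psi] are taken on L^3 instead of L^3/L^4, and [phi^-1] is the
   library's linear section of [phi] over its image L^5; [psi] vanishes on
   the kernel L^4 of [phi], so on L^5 [tau] does not depend on the section. *)
Definition phi : 'Hom(subvs_of (lcs L 3), L) :=
  (saa_mulr (b (y_ 2)) \o linfun vsval)%VF.
Definition psi : 'Hom(subvs_of (lcs L 3), L) :=
  (saa_mulr (b (y_ 3)) \o linfun vsval)%VF.
Definition tau : 'End(L) := (psi \o phi^-1)%VF.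

Definition L5_basis : 2.-tuple L := [tuple b (x_ 5); b (x_ 4)].

Definition tau_mx : 'M[F]_2 :=
  \matrix_(i, j) coord L5_basis j (tau (tnth L5_basis i)).

Definition tau_minpoly : {poly F} := mxminpoly tau_mx.

End AdaptedBasis.

(* Both conditions are independent of the choice of the adapted basis. *)
Definition type_C_nonzero_linear_term (F : fieldType) (L : saa F) : Prop :=
  exists b : gen -> L,
    [/\ adapted_basis b,
        irreducible_poly (tau_minpoly b) &
        (tau_minpoly b)`_1 != 0].

Definition quadratic (F : fieldType) (r s : F) : {poly F} :=
  'X^2 + r *: 'X + s%:P.

Definition admissible (F : fieldType) (gamma r s : F) : Prop :=
  [/\ gamma != 0, r != 0 & irreducible_poly (quadratic r s)].

Definition Hset (F : fieldType) (r z : F) : Prop :=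
  exists x, z = x ^+ 2 + r * x.

Definition Gset (F : fieldType) (r s z : F) : Prop :=
  exists x y, (x, y) != (0, 0) /\ z = x ^+ 2 + r * x * y + s * y ^+ 2.

Definition nonzero_cube (F : fieldType) (z : F) : Prop :=
  exists2 b, b != 0 & z = b ^+ 3.

(* Non-vacuity: the data of [P10_3_9] do define an algebra. *)
Section Existence.
Variables (F : fieldType) (gamma r s : F).

Let V : vectType F := 'rV[F]_(5 + 5).

Let ix (g : gen) : 'I_(5 + 5) := unsplit g.
Let cf (g : gen) (v : V) : F := v 0 (ix g).

(* the alternating trilinear form with value c on each entry *)
Let det3 (e : gen * gen * gen * F) (u v w : V) : F :=
  let: (a, b, d, c) := e in
  c * (cf a u * (cf b v * cf d w - cf d v * cf b w)
     - cf b u * (cf a v * cf d w - cf d v * cf a w)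
     + cf d u * (cf a v * cf b w - cf b v * cf a w)).

Let P := P10_3_9 gamma r s.
Let T (u v w : V) : F := \sum_(e <- P) det3 e u v w.

Let E (g : gen) : V := delta_mx 0 (ix g).

Let om (u v : V) : F :=
  \sum_(i < 5) (cf (inl i) u * cf (inr i) v - cf (inr i) u * cf (inl i) v).

Let mu (u v : V) : V :=
  \row_j match split j with
         | inl i => T u v (E (inr i))
         | inr i => - T u v (E (inl i))
         end.

Let cfD g u v : cf g (u + v) = cf g u + cf g v.
Proof. by rewrite /cf mxE. Qed.

Let cfZ g a v : cf g (a *: v) = a * cf g v.
Proof. by rewrite /cf mxE. Qed.

Let cfE g h : cf g (E h) = (g == h)%:R.
Proof.
by rewrite /cf /E mxE eqxx /= /ix (can_eq (@unsplitK 5 5)).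
Qed.

Let cf_mu g u v : cf g (mu u v) =
  match g with inl i => T u v (E (inr i)) | inr i => - T u v (E (inl i)) end.
Proof. by rewrite /cf /mu mxE /ix unsplitK. Qed.

Let decomp (v : V) : v = \sum_g cf g v *: E g.
Proof.
rewrite [LHS]row_sum_delta (reindex ix) //=.
by exists (@split 5 5) => i _; [apply: unsplitK | apply: splitK].
Qed.

Let T_cyc u v w : T u v w = T v w u.
Proof. by apply: eq_bigr => -[[[x y] z] c] _ /=; ring. Qed.

Let T_alt u w : T u u w = 0.
Proof. by rewrite /T big1 // => -[[[x y] z] c] _ /=; ring. Qed.

Let T_lin3 u v a w w' : T u v (a *: w + w') = a * T u v w + T u v w'.
Proof.
rewrite /T mulr_sumr -big_split /=; apply: eq_bigr => -[[[x y] z] c] _ /=.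
by rewrite !cfD !cfZ; ring.
Qed.

Let T_sum u v w : T u v w = \sum_g cf g w * T u v (E g).
Proof.
have T0 : T u v 0 = 0 by have := T_lin3 u v (-1) 0 0; rewrite addr0 scaler0 mulN1r addNr.
have TD : {morph T u v : x y / x + y}.
  by move=> x y; rewrite -[x]scale1r T_lin3 scale1r mul1r.
rewrite {1}[w]decomp (big_morph _ TD T0); apply: eq_bigr => g _.
by rewrite -[_ *: _]addr0 T_lin3 T0 addr0.
Qed.

Let om_lin2 u a v v' : om u (a *: v + v') = a * om u v + om u v'.
Proof.
rewrite /om mulr_sumr -big_split /=; apply: eq_bigr => i _.
by rewrite !cfD !cfZ; ring.
Qed.

Let om_lin1 v a u u' : om (a *: u + u') v = a * om u v + om u' v.
Proof.
rewrite /om mulr_sumr -big_split /=; apply: eq_bigr => i _.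
by rewrite !cfD !cfZ; ring.
Qed.

Let om_bilinear : bilinear_for
  (GRing.Scale.Law.clone _ _ *%R _) (GRing.Scale.Law.clone _ _ *%R _)
  (om : V -> V -> F).
Proof. by split=> u a v w /=; [apply: om_lin1 | apply: om_lin2]. Qed.

Let om_pack : {biscalar V} :=
  HB.pack_for {biscalar V} (om : V -> V -> F)
    (@bilinear_isBilinear.Build F V V F _ _ om om_bilinear).

Let mu_lin2 u a v v' : mu u (a *: v + v') = a *: mu u v + mu u v'.
Proof.
by apply/rowP=> j; rewrite !mxE; case: (split j) => i;
  rewrite -![T u _ _]T_cyc T_lin3; ring.
Qed.

Let mu_lin1 v a u u' : mu (a *: u + u') v = a *: mu u v + mu u' v.
Proof.
by apply/rowP=> j; rewrite !mxE; case: (split j) => i;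
  rewrite !(T_cyc _ v) T_lin3; ring.
Qed.

Let mu_bilinear : bilinear_for
  (GRing.Scale.Law.clone _ _ *:%R _) (GRing.Scale.Law.clone _ _ *:%R _)
  (mu : V -> V -> V).
Proof. by split=> u a v w /=; [apply: mu_lin1 | apply: mu_lin2]. Qed.

Let mu_pack : {bilinear V -> V -> V} :=
  HB.pack_for {bilinear V -> V -> V} (mu : V -> V -> V)
    (@bilinear_isBilinear.Build F V V V _ _ mu mu_bilinear).

Let om_alt u : om_pack u u = 0.
Proof. by rewrite /= /om big1 // => i _; ring. Qed.

Let omEr u i : om u (E (inr i)) = cf (inl i) u.
Proof.
have sE (k k' : 'I_5) : ((inl k == inr k' :> gen) = false) *
  ((inr k == inl k' :> gen) = false) by [].
rewrite /om (bigD1 i) //= big1 => [|j ji]; rewrite !cfE !sE ?eqxx.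
  by rewrite ?mulr0 ?mulr1; ring.
have -> : (inr j == inr i :> gen) = false by apply: negbTE ji.
by rewrite !mulr0 subr0.
Qed.

Let omEl u i : om u (E (inl i)) = - cf (inr i) u.
Proof.
have sE (k k' : 'I_5) : ((inl k == inr k' :> gen) = false) *
  ((inr k == inl k' :> gen) = false) by [].
rewrite /om (bigD1 i) //= big1 => [|j ji]; rewrite !cfE !sE ?eqxx.
  by rewrite ?mulr0 ?mulr1; ring.
have -> : (inl j == inl i :> gen) = false by apply: negbTE ji.
by rewrite !mulr0 subr0.
Qed.

Let om_nondeg u : (forall v, om_pack u v = 0) -> u = 0.
Proof.
move=> u0; rewrite [u]decomp big1 // => -[] i _.
  by have := u0 (E (inr i)); rewrite /= omEr => ->; rewrite scale0r.
have := u0 (E (inl i)); rewrite /= omEl => /eqP; rewrite oppr_eq0 => /eqP ->.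
by rewrite scale0r.
Qed.

Let mu_alt u : mu_pack u u = 0.
Proof. by apply/rowP=> j; rewrite !mxE; case: (split j) => i; rewrite T_alt ?oppr0. Qed.

Let om_mu u v w : om (mu u v) w = T u v w.
Proof.
rewrite T_sum big_sumType /= -big_split /=; apply: eq_bigr => i _.
by rewrite !cf_mu; ring.
Qed.

Let om_cyc u v w : om_pack (mu_pack u v) w = om_pack (mu_pack v w) u.
Proof. by rewrite /= !om_mu T_cyc. Qed.

Let A : saa F := SAA om_alt om_nondeg mu_alt om_cyc.

Let E_std : standard_basis (L := A) E.
Proof.
split=> [|i j|i j|i j].
- rewrite basisEdim size_codom card_sum !card_ord dimvf /= /dim /= mul1n leqnn andbT.
  apply/subvP => v _; rewrite [v]decomp; apply: memv_suml => g _.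
  by rewrite memvZ // memv_span // codom_f.
- by rewrite /= omEl cfE oppr0.
- by rewrite /= omEr cfE.
- by rewrite /= omEr cfE eq_sym.
Qed.

Lemma P10_3_9_exists : exists L : saa F, has_presentation L (P10_3_9 gamma r s).
Proof.
exists A, E; split; first exact: E_std.
- have ltE k l : (k < 5)%N -> (l < 5)%N ->
      ((inord k : 'I_5) == inord l) = (k == l).
    by move=> k5 l5; rewrite -val_eqE /= !inordK.
  have xE k l : (k.-1 < 5)%N -> (l.-1 < 5)%N -> (x_ k == x_ l) = (k.-1 == l.-1).
    exact: ltE.
  have yE k l : (k.-1 < 5)%N -> (l.-1 < 5)%N -> (y_ k == y_ l) = (k.-1 == l.-1).
    exact: ltE.
  have xyE k l : ((x_ k == y_ l) = false) * ((y_ k == x_ l) = false) by [].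
  move=> u v w c; rewrite /= om_mu /T !inE => uP.
  do 5?[case/orP: uP => uP]; case/eqP: uP => -> -> -> ->;
  rewrite !big_cons big_nil /det3 !cfE !xyE;
  repeat (rewrite xE //); repeat (rewrite yE //); rewrite /=; ring.
- move=> u v w nP; rewrite /= om_mu /T big1_seq // => -[[[x y] z] c] /= eP.
  have {nP eP} nP := nP _ _ _ _ eP.
  have z3 (a b d : bool) : ~ [&& a, b & d] -> a%:R * b%:R * d%:R = 0 :> F.
    by case: a; case: b; case: d => // h; rewrite ?(mulr0, mul0r) //; case: h.
  have t g h k : ~~ perm_eq [:: u; v; w] [:: g; h; k] ->
      (g == u)%:R * (h == v)%:R * (k == w)%:R = 0 :> F.
    move=> n; apply: z3 => /and3P[/eqP eg /eqP eh /eqP ek].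
    by rewrite eg eh ek perm_refl in n.
  have perms g h k : perm_eq [:: g; h; k] [:: x; y; z] ->
      ~~ perm_eq [:: u; v; w] [:: g; h; k].
    by move=> e; apply: contra nP => e'; apply: perm_trans e' e.
  have pE : (perm_eq [:: x; y; z] [:: x; y; z] * perm_eq [:: x; z; y] [:: x; y; z] *
      perm_eq [:: y; x; z] [:: x; y; z] * perm_eq [:: y; z; x] [:: x; y; z] *
      perm_eq [:: z; x; y] [:: x; y; z] * perm_eq [:: z; y; x] [:: x; y; z])%type.
    by do !split; apply/allP => g _ /=; rewrite !addn0; apply/eqP; lia.
  have e1 := t _ _ _ (perms _ _ _ pE.1.1.1.1.1).
  have e2 := t _ _ _ (perms _ _ _ pE.1.1.1.1.2).
  have e3 := t _ _ _ (perms _ _ _ pE.1.1.1.2).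
  have e4 := t _ _ _ (perms _ _ _ pE.1.1.2).
  have e5 := t _ _ _ (perms _ _ _ pE.1.2).
  have e6 := t _ _ _ (perms _ _ _ pE.2).
  rewrite !cfE; move: e1 e2 e3 e4 e5 e6.
  set a1 := (x == u)%:R; set a2 := (x == v)%:R; set a3 := (x == w)%:R.
  set b1 := (y == u)%:R; set b2 := (y == v)%:R; set b3 := (y == w)%:R.
  set d1 := (z == u)%:R; set d2 := (z == v)%:R; set d3 := (z == w)%:R.
  move=> e1 e2 e3 e4 e5 e6.
  transitivity (c * (a1 * b2 * d3 - a1 * d2 * b3 - b1 * a2 * d3 + b1 * d2 * a3
    + d1 * a2 * b3 - d1 * b2 * a3)); first by ring.
  by rewrite e1 e2 e3 e4 e5 e6; ring.
Qed.
End Existence.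

(* Main.v *)
From HB Require Import structures.
Require Import Defs.
From mathcomp Require Import all_boot all_order all_algebra.
From mathcomp Require Import ring.

Import GRing.Theory.
Local Open Scope ring_scope.
Set Implicit Arguments.
Unset Strict Implicit.
Unset Printing Implicit Defensive.

(** Write T(u, v, w) for (uv, w), an alternating trilinear form. As the form
    ( , ) is non-degenerate, T determines the product, so that presenting an
    algebra means listing the values of T on a standard basis. In an adapted
    basis the central series kill T on all but fifteen triples of basis
    elements ([flag_basis], [triple_expand]), which makes T an explicit
    polynomial in coordinates and turns every change of basis into a
    computation with rows of coordinates ([triple_rows]).

    Existence of the presentation. Eight of the fifteen values are the entries
    of the maps phi and psi from <x1, y1> to <x4, x5>, which gives the matrix
    of tau = psi phi^-1 ([tau_mxE]). This matrix is not scalar: if tau were a,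
    then y3 - a y2 would be in Z_3(L) ([tau_not_scalar]). So the irreducible
    minimal polynomial of tau is its characteristic polynomial, tau has no
    eigenvector, and x5 and tau(x5) form a basis of L^5. Taking tau(x5) as x4,
    the preimages under phi of x4 and x5 as x1 and y1, and scaling y3 until
    (x1, y1) = 1, one reaches phi = 1 and tau in companion form, with
    r = tr tau and s = - det tau ([normalise_tau]). The other values are
    cleared by a symplectic change of basis that uses gamma <> 0
    ([clear_coefs]).

    Isomorphism. Algebras with the same presentation are isomorphic
    ([presenting_iso]), and an isomorphism carries a presentation along, so
    the question is which parameters occur in one algebra. All presenting
    bases are adapted to the same lower central series. Modulo lower terms a
    second one therefore has
      y2' = a y2, y3' = a (d y3 + e y2), x5' = w := k x5 + l x4,
    hence tau' = d tau + e and x4' = tau'(w). The condition (x1', y1') = 1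
    then reads d q(k, l) = a^2, where
      q(k, l) = (phi^-1 tau w, phi^-1 w) = k^2 + r k l - s l^2,
    and comparing trace, determinant and the value on x2, y4, y5 gives
      gamma' = gamma / a^3, r' = d r + 2 e, s' = d^2 s - d e r - e^2
    ([compare_presentations]). Conversely all a, e, k, l with a and q(k, l)
    non-zero occur ([rescale_presentation]). In characteristic 2 the values
    of q at (k, l) <> (0, 0) form G(r, s), and
    d = a^2 / q(k, l) = q(d k / a, d l / a) runs through the same set, while
    r' = d r and s' - d^2 s = e^2 + r' e. *)

(** * The trilinear form and coordinates in a standard basis *)
Section Trilinear.
Variables (F : fieldType) (L : saa F).
Implicit Types u v w e f : L.

Definition triple u v w : F := saa_form (saa_mul u v) w.

Lemma tripleDl u u' v w : triple (u + u') v w = triple u v w + triple u' v w.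
Proof. by rewrite /triple linearDl linearDl. Qed.
Lemma tripleZl a u v w : triple (a *: u) v w = a * triple u v w.
Proof. by rewrite /triple linearZl_LR linearZl_LR. Qed.
Lemma tripleDm u v v' w : triple u (v + v') w = triple u v w + triple u v' w.
Proof. by rewrite /triple linearDr linearDl. Qed.
Lemma tripleZm a u v w : triple u (a *: v) w = a * triple u v w.
Proof. by rewrite /triple linearZr_LR linearZl_LR. Qed.
Lemma tripleDr u v w w' : triple u v (w + w') = triple u v w + triple u v w'.
Proof. by rewrite /triple linearDr. Qed.
Lemma tripleZr a u v w : triple u v (a *: w) = a * triple u v w.
Proof. by rewrite /triple linearZr_LR. Qed.

Lemma form_antisym u v : saa_form u v = - saa_form v u.
Proof.
have := saa_formxx (u + v).
rewrite linearDl !linearDr /= !saa_formxx add0r addr0 => /eqP.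
by rewrite addr_eq0 => /eqP.
Qed.

Lemma mul_anticomm u v : saa_mul u v = - saa_mul v u.
Proof.
have := saa_mulxx (u + v).
rewrite linearDl !linearDr /= !saa_mulxx add0r addr0 => /eqP.
by rewrite addr_eq0 => /eqP.
Qed.

Lemma triple_cycle u v w : triple u v w = triple v w u.
Proof. exact: saa_form_mul_cycle. Qed.
Lemma triple_swapl u v w : triple u v w = - triple v u w.
Proof. by rewrite /triple mul_anticomm linearNl. Qed.
Lemma triple_swapr u v w : triple u v w = - triple u w v.
Proof.
by rewrite triple_cycle triple_swapl -triple_cycle -triple_cycle -triple_cycle.
Qed.
Lemma triple_uuw u w : triple u u w = 0.
Proof. by rewrite /triple saa_mulxx linear0l. Qed.
Lemma triple_uvv u v : triple u v v = 0.
Proof. by rewrite triple_cycle triple_uuw. Qed.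
Lemma triple_uvu u v : triple u v u = 0.
Proof. by rewrite -triple_cycle triple_uuw. Qed.

Lemma form_ext u v : (forall w, saa_form u w = saa_form v w) -> u = v.
Proof.
move=> uv; apply/eqP; rewrite -subr_eq0; apply/eqP/saa_form_nondegenerate => w.
by rewrite linearBl /= uv subrr.
Qed.

Lemma mul_eq0 u v : (forall w, triple u v w = 0) -> saa_mul u v = 0.
Proof. exact: saa_form_nondegenerate. Qed.

(** Splitting one basis vector off each argument at a time keeps the expansion
    of an alternating form short: the terms repeating that vector never
    appear, and the rest come out in a fixed order of the arguments. *)
Lemma triple_peel3 e a b c u v w :
  triple (a *: e + u) (b *: e + v) (c *: e + w) =
  a * triple e v w - b * triple e u w + c * triple e u v + triple u v w.
Proof.
rewrite !(tripleDl, tripleDm, tripleDr, tripleZl, tripleZm, tripleZr).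
rewrite !(triple_uuw, triple_uvv, triple_uvu).
by rewrite (triple_swapl u e w) -(triple_cycle e u v); ring.
Qed.

Lemma triple_peel2 e f a b u v :
  triple e (a *: f + u) (b *: f + v) =
  a * triple e f v - b * triple e f u + triple e u v.
Proof.
rewrite !(tripleDm, tripleDr, tripleZm, tripleZr) triple_uvv.
by rewrite (triple_swapr e u f); ring.
Qed.

Lemma triple_peel1 e f g a u :
  triple e f (a *: g + u) = a * triple e f g + triple e f u.
Proof. by rewrite tripleDr tripleZr. Qed.

Section Coordinates.
Variable b : gen -> L.

(** By duality, the coordinate along a standard basis element is the value of
    the form against its partner; it is linear whatever [b] is. *)
Definition crd (g : gen) (v : L) : F :=
  match g with
  | inl i => saa_form v (b (inr i))
  | inr i => saa_form (b (inl i)) v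
  end.
Arguments crd : simpl never.

Lemma crdD g u v : crd g (u + v) = crd g u + crd g v.
Proof. by case: g => i; rewrite /crd /= ?linearDr // linearDl. Qed.
Lemma crdZ g a v : crd g (a *: v) = a * crd g v.
Proof. by case: g => i; rewrite /crd /= ?linearZr_LR // linearZl_LR. Qed.

Lemma crd0 g : crd g 0 = 0.
Proof. by have := crdZ g 0 0; rewrite scaler0 mul0r. Qed.

Lemma crd_sum g I (r : seq I) (f : I -> L) :
  crd g (\sum_(i <- r) f i) = \sum_(i <- r) crd g (f i).
Proof. exact: (big_morph (crd g) (crdD g) (crd0 g)). Qed.

Definition standard_form : Prop :=
  [/\ forall i j, saa_form (b (inl i)) (b (inl j)) = 0,
      forall i j, saa_form (b (inr i)) (b (inr j)) = 0 &
      forall i j, saa_form (b (inl i)) (b (inr j)) = (i == j)%:R].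

Lemma crd_standard g h : standard_form -> crd g (b h) = (g == h)%:R.
Proof.
case=> bxx byy bxy; case: g h => i [] j; rewrite /crd /= ?bxx ?byy ?bxy // eq_sym.
by congr (_%:R); congr nat_of_bool; apply/eqP/eqP => [->//|[]].
Qed.

(** Pairing a linear relation with the dual elements shows that it is trivial,
    so the values of the form force ten vectors to be a basis. *)
Lemma standard_form_basis :
  \dim {:L} = 10%N -> standard_form -> standard_basis b.
Proof.
move=> dimL bP; case: (bP) => *; split=> //.
have sz : size (codom b) = 10%N by rewrite size_codom card_sum !card_ord.
rewrite basisEfree subvf sz dimL leqnn !andbT.
suff: free (in_tuple (codom b)) by []. apply/freeP => k k0 i.
pose g (j : 'I_(size (codom b))) := enum_val (cast_ord (size_codom b) j).
have gE (j : 'I_(size (codom b))) : (codom b)`_j = b (g j).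
  exact: (nth_codom 0 b (cast_ord (size_codom b) j)).
have := crd0 (g i); rewrite -{1}k0 crd_sum (bigD1 i) //=.
rewrite crdZ gE crd_standard // eqxx mulr1 big1 ?addr0 // => j ji.
rewrite crdZ gE crd_standard // (inj_eq enum_val_inj) (inj_eq (@cast_ord_inj _ _ _)).
by rewrite eq_sym (negbTE ji) mulr0.
Qed.

Hypothesis bP : standard_basis b.

Lemma standard_basis_form : standard_form.
Proof. by case: bP. Qed.

Lemma crd_basis g h : crd g (b h) = (g == h)%:R.
Proof. exact: crd_standard standard_basis_form. Qed.

Lemma standard_basis_dim : \dim {:L} = 10%N.
Proof.
case: bP => /eqP + _ _ _; rewrite /basis_of => /eqP /andP[/eqP <-].
by rewrite /free => /eqP ->; rewrite size_codom card_sum !card_ord.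
Qed.

Lemma form_basis_ext u v :
  (forall g, saa_form u (b g) = saa_form v (b g)) -> u = v.
Proof.
move=> uv; apply: form_ext => w.
have bas : basis_of fullv (in_tuple (codom b)) by case: bP.
rewrite (coord_basis bas (memvf w)) !linear_sumr; apply: eq_bigr => i _.
rewrite !linearZr_LR /=; congr (_ * _).
by have /codomP[g ->] : (codom b)`_i \in codom b by rewrite mem_nth.
Qed.

Lemma crd_ext u v : (forall g, crd g u = crd g v) -> u = v.
Proof.
move=> uv; apply: form_basis_ext => -[] i; last exact: (uv (inl i)).
by rewrite form_antisym [RHS]form_antisym; congr (- _); apply: (uv (inr i)).
Qed.

Lemma crd_combination g (f : gen -> F) : crd g (\sum_h f h *: b h) = f g.
Proof.
rewrite crd_sum (bigD1 g) //= crdZ crd_basis eqxx mulr1.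
rewrite big1 /= ?addr0 // => h hg.
by rewrite crdZ crd_basis eq_sym (negbTE hg) mulr0.
Qed.

Lemma crd_span v : v = \sum_g crd g v *: b g.
Proof. by apply: crd_ext => g; rewrite crd_combination. Qed.

Lemma form_crd u v : saa_form u v =
  \sum_(i < 5) (crd (inl i) u * crd (inr i) v - crd (inr i) u * crd (inl i) v).
Proof.
rewrite {1}(crd_span u) linear_sumlz big_sumType /= -big_split /=.
apply: eq_bigr => i _; rewrite !linearZl_LR /=.
by rewrite [saa_form (b (inr i)) v]form_antisym mulrN.
Qed.

End Coordinates.
End Trilinear.
Arguments crd : simpl never.

(** * The triples that survive in an adapted basis *)
Lemma gen_ind (P : gen -> Prop) :
  P (x_ 1) -> P (x_ 2) -> P (x_ 3) -> P (x_ 4) -> P (x_ 5) ->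
  P (y_ 1) -> P (y_ 2) -> P (y_ 3) -> P (y_ 4) -> P (y_ 5) -> forall g, P g.
Proof.
rewrite /x_ /y_ /= => x1 x2 x3 x4 x5 y1 y2 y3 y4 y5.
by case=> i; rewrite -[i]inord_val; case: i => [[|[|[|[|[|]]]]]].
Qed.

(** The names of the basis elements do not compute, as [inord] is locked by a
    proof; their positions in the list x1, ..., x5, y1, ..., y5 do. *)
Definition gen_code (g : gen) : nat :=
  match g with inl i => i | inr i => (i + 5)%N end.

Lemma gen_code_inj : injective gen_code.
Proof.
case=> i [] j /= e; try by congr (_ _); apply: val_inj => //=; apply: (addIn e).
- by have := ltn_ord i; rewrite e ltnNge leq_addl.
- by have := ltn_ord j; rewrite -e ltnNge leq_addl.
Qed.

Lemma gen_code_lt g : (gen_code g < 10)%N.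
Proof.
case: g => i /=; first exact: leq_trans (ltn_ord i) _.
by rewrite -[10%N]/(5 + 5)%N ltn_add2r.
Qed.

Arguments gen_code : simpl never.

Lemma gen_codeE :
  (gen_code (x_ 1) = 0%N) * (gen_code (x_ 2) = 1%N) * (gen_code (x_ 3) = 2%N) *
  (gen_code (x_ 4) = 3%N) * (gen_code (x_ 5) = 4%N) * (gen_code (y_ 1) = 5%N) *
  (gen_code (y_ 2) = 6%N) * (gen_code (y_ 3) = 7%N) * (gen_code (y_ 4) = 8%N) *
  (gen_code (y_ 5) = 9%N).
Proof. by rewrite /gen_code /x_ /y_ !inordK. Qed.

(* Unification would otherwise compare x_ 1 with x_ 2 by unfolding [inord]. *)
Opaque x_ y_.

Section Flag.
Variables (F : fieldType) (L : saa F).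
Implicit Types (u v w : L) (b : gen -> L).

(** The 3 x 3 minor of the coordinates of u, v, w along g, h, k. *)
Definition minor3 b (g h k : gen) u v w : F :=
  crd b g u * (crd b h v * crd b k w - crd b k v * crd b h w)
  - crd b h u * (crd b g v * crd b k w - crd b k v * crd b g w)
  + crd b k u * (crd b g v * crd b h w - crd b h v * crd b g w).

(** The vanishing that every adapted basis and every basis giving the
    presentation have in common. *)
Record flag_basis b : Prop := FlagBasis {
  flag_standard : standard_basis b;
  flag_x3 : forall u v, triple (b (x_ 3)) u v = 0;
  flag_x4 : forall u v, triple (b (x_ 4)) u v = 0;
  flag_x5 : forall u v, triple (b (x_ 5)) u v = 0;
  flag_x2x1 : forall u, triple (b (x_ 2)) (b (x_ 1)) u = 0;
  flag_x2y1 : forall u, triple (b (x_ 2)) (b (y_ 1)) u = 0;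
  flag_x2y2 : forall u, triple (b (x_ 2)) (b (y_ 2)) u = 0;
  flag_x2y3 : forall u, triple (b (x_ 2)) (b (y_ 3)) u = 0;
  flag_x1y1 : forall u, triple (b (x_ 1)) (b (y_ 1)) u = 0;
  flag_x1y2y3 : triple (b (x_ 1)) (b (y_ 2)) (b (y_ 3)) = 0;
  flag_y1y2y3 : triple (b (y_ 1)) (b (y_ 2)) (b (y_ 3)) = 0 }.

Definition flag_triples : seq (gen * gen * gen) :=
  [:: (x_ 2, y_ 4, y_ 5);
      (x_ 1, y_ 2, y_ 4); (x_ 1, y_ 2, y_ 5);
      (x_ 1, y_ 3, y_ 4); (x_ 1, y_ 3, y_ 5); (x_ 1, y_ 4, y_ 5);
      (y_ 1, y_ 2, y_ 4); (y_ 1, y_ 2, y_ 5);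
      (y_ 1, y_ 3, y_ 4); (y_ 1, y_ 3, y_ 5); (y_ 1, y_ 4, y_ 5);
      (y_ 2, y_ 3, y_ 4); (y_ 2, y_ 3, y_ 5); (y_ 2, y_ 4, y_ 5);
      (y_ 3, y_ 4, y_ 5)].

(** x2, x1, y1 come first because most of the vanishing products of
    [flag_basis] start with them; the central x3, x4, x5 come last. *)
Lemma gen_span b (f : gen -> F) : \sum_g f g *: b g =
  f (x_ 2) *: b (x_ 2) + (f (x_ 1) *: b (x_ 1) + (f (y_ 1) *: b (y_ 1) +
  (f (y_ 2) *: b (y_ 2) + (f (y_ 3) *: b (y_ 3) + (f (y_ 4) *: b (y_ 4) +
  (f (y_ 5) *: b (y_ 5) + (f (x_ 3) *: b (x_ 3) +
  (f (x_ 4) *: b (x_ 4) + f (x_ 5) *: b (x_ 5))))))))).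
Proof.
pose s := [:: x_ 2; x_ 1; y_ 1; y_ 2; y_ 3; y_ 4; y_ 5; x_ 3; x_ 4; x_ 5].
have gen_perm : perm_eq (index_enum gen) s.
  apply: uniq_perm; first exact: index_enum_uniq.
    by rewrite -(map_inj_uniq gen_code_inj) /= !gen_codeE.
  move=> g; rewrite mem_index_enum -(mem_map gen_code_inj) /= !gen_codeE.
  by elim/gen_ind: g; rewrite gen_codeE.
by rewrite (perm_big _ gen_perm) !big_cons big_nil /= addr0.
Qed.

(** The central part of each argument drops out, and of the 35 triples among
    x2, x1, y1, ..., y5 the fields of [flag_basis] leave fifteen. *)
Lemma triple_expand b u v w : flag_basis b ->
  triple u v w = \sum_(e <- flag_triples)
    triple (b e.1.1) (b e.1.2) (b e.2) * minor3 b e.1.1 e.1.2 e.2 u v w.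
Proof.
case=> bP x3 x4 x5 x2x1 x2y1 x2y2 x2y3 x1y1 x1y2y3 y1y2y3.
rewrite !big_cons big_nil /= /minor3.
have spanE t : exists2 z, forall t1 t2, triple z t1 t2 = 0 & t =
    crd b (x_ 2) t *: b (x_ 2) + (crd b (x_ 1) t *: b (x_ 1) +
    (crd b (y_ 1) t *: b (y_ 1) + (crd b (y_ 2) t *: b (y_ 2) +
    (crd b (y_ 3) t *: b (y_ 3) + (crd b (y_ 4) t *: b (y_ 4) +
    (crd b (y_ 5) t *: b (y_ 5) + z)))))).
  eexists; last by rewrite {1}(crd_span bP t) gen_span.
  by move=> t1 t2; rewrite !(tripleDl, tripleZl) x3 x4 x5; ring.
have [z zC uE] := spanE u; have [z' zC' vE] := spanE v.
have [z'' zC'' wE] := spanE w.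
rewrite {1}uE {1}vE {1}wE; clear uE vE wE spanE x3 x4 x5 bP.
set crdu := crd b ^~ u; set crdv := crd b ^~ v; set crdw := crd b ^~ w.
rewrite -!/(crdu _) -!/(crdv _) -!/(crdw _).
move: crdu crdv crdw => cu cv cw.
(* With variables for the basis vectors, rewriting only compares variables. *)
move: (b (x_ 1)) (b (x_ 2)) (b (y_ 1)) (b (y_ 2)) (b (y_ 3)) (b (y_ 4))
  (b (y_ 5)) x2x1 x2y1 x2y2 x2y3 x1y1 x1y2y3 y1y2y3.
move: (cu (x_ 1)) (cu (x_ 2)) (cu (y_ 1)) (cu (y_ 2)) (cu (y_ 3))
  (cu (y_ 4)) (cu (y_ 5)) => u1 u2 u1' u2' u3' u4' u5'.
move: (cv (x_ 1)) (cv (x_ 2)) (cv (y_ 1)) (cv (y_ 2)) (cv (y_ 3))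
  (cv (y_ 4)) (cv (y_ 5)) => v1 v2 v1' v2' v3' v4' v5'.
move: (cw (x_ 1)) (cw (x_ 2)) (cw (y_ 1)) (cw (y_ 2)) (cw (y_ 3))
  (cw (y_ 4)) (cw (y_ 5)) => w1 w2 w1' w2' w3' w4' w5'.
move=> X1 X2 Y1 Y2 Y3 Y4 Y5 x2x1 x2y1 x2y2 x2y3 x1y1 x1y2y3 y1y2y3.
have zm t1 t2 : triple t1 z' t2 = 0 by rewrite triple_cycle zC'.
have zr t1 t2 t3 (t0 : forall u v, triple t3 u v = 0) : triple t1 t2 t3 = 0.
  by rewrite -triple_cycle t0.
rewrite !triple_peel3 zC !triple_peel2 !(x2x1, x2y1, x2y2, x2y3, x1y1).
rewrite !zm !triple_peel1.
rewrite !(x1y2y3, y1y2y3) !(zr _ _ _ zC) ?(zr _ _ _ zC') ?(zr _ _ _ zC'').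
ring.
Qed.
End Flag.

(** * Change of basis by rows of coordinates *)
Section ChangeOfBasis.
Variables (F : fieldType) (L : saa F) (b : gen -> L).

Definition change_basis (A : seq (seq F)) (h : gen) : L :=
  \sum_g (nth [::] A (gen_code h))`_(gen_code g) *: b g.

Hypothesis bP : standard_basis b.

Lemma crd_change A g h :
  crd b g (change_basis A h) = (nth [::] A (gen_code h))`_(gen_code g).
Proof. exact: crd_combination. Qed.

(** Only i < j is asked for, since the form is alternating. *)
Definition symplectic_rows (A : seq (seq F)) : Prop :=
  forall i j, (i < j < 10)%N ->
  \sum_(k < 5) ((nth [::] A i)`_k * (nth [::] A j)`_(k + 5)
              - (nth [::] A i)`_(k + 5) * (nth [::] A j)`_k) = (j == i + 5)%N%:R.

Lemma change_basis_standard A :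
  symplectic_rows A -> standard_basis (change_basis A).
Proof.
move=> sA.
have formE g h : (gen_code g < gen_code h)%N ->
    saa_form (change_basis A g) (change_basis A h) =
    (gen_code h == gen_code g + 5)%N%:R.
  move=> gh; rewrite (form_crd bP) -sA ?gh ?gen_code_lt //.
  by apply: eq_bigr => i _; rewrite !crd_change.
apply: standard_form_basis; first exact: standard_basis_dim bP.
have xx (i j : 'I_5) : (i < j)%N ->
    saa_form (change_basis A (inl i)) (change_basis A (inl j)) = 0.
  move=> ij; rewrite formE // /gen_code (_ : _ == _ = false) //.
  by apply/eqP => e; have := ltn_ord j; rewrite e ltnNge leq_addl.
have yy (i j : 'I_5) : (i < j)%N ->
    saa_form (change_basis A (inr i)) (change_basis A (inr j)) = 0.
  move=> ij; rewrite formE /gen_code ?ltn_add2r // eqn_add2r (_ : _ == _ = false) //.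
  by apply/eqP => e; have := ltn_ord j; rewrite e ltnNge leq_addl.
split=> i j.
- case: (ltngtP i j) => [/xx //|/xx e|/val_inj ->].
    by rewrite form_antisym e oppr0.
  by rewrite saa_formxx.
- case: (ltngtP i j) => [/yy //|/yy e|/val_inj ->].
    by rewrite form_antisym e oppr0.
  by rewrite saa_formxx.
- rewrite formE /gen_code ?eqn_add2r ?(eq_sym i) //.
  by rewrite (leq_trans (ltn_ord i)) // leq_addl.
Qed.
End ChangeOfBasis.

Section Presentation.
Variables (F : fieldType) (L : saa F).
Implicit Types (b : gen -> L).

Definition flag_coefs b : seq F :=
  [seq triple (b e.1.1) (b e.1.2) (b e.2) | e <- flag_triples].

Definition coords b u : seq F :=
  [:: crd b (x_ 1) u; crd b (x_ 2) u; crd b (x_ 3) u; crd b (x_ 4) u;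
      crd b (x_ 5) u; crd b (y_ 1) u; crd b (y_ 2) u; crd b (y_ 3) u;
      crd b (y_ 4) u; crd b (y_ 5) u].

(** [minor3] and the sum of [triple_expand] on plain rows of coordinates, with
    positions in place of names, so that they reduce on explicit rows. *)
Definition row_minor (i j k : nat) (u v w : seq F) : F :=
  u`_i * (v`_j * w`_k - v`_k * w`_j) - u`_j * (v`_i * w`_k - v`_k * w`_i)
  + u`_k * (v`_i * w`_j - v`_j * w`_i).

Definition row_triple (cs u v w : seq F) : F :=
  foldr +%R 0 [seq e.1 * row_minor e.2.1.1 e.2.1.2 e.2.2 u v w | e <-
    zip cs [:: (1, 8, 9); (0, 6, 8); (0, 6, 9); (0, 7, 8); (0, 7, 9);
               (0, 8, 9); (5, 6, 8); (5, 6, 9); (5, 7, 8); (5, 7, 9);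
               (5, 8, 9); (6, 7, 8); (6, 7, 9); (6, 8, 9); (7, 8, 9)]%N].

Lemma triple_rows b u v w : flag_basis b ->
  triple u v w = row_triple (flag_coefs b) (coords b u) (coords b v) (coords b w).
Proof. by move=> bF; rewrite (triple_expand _ _ _ bF) !big_cons big_nil. Qed.

Lemma coords_change b A g : standard_basis b ->
  coords b (change_basis b A g) =
  [seq (nth [::] A (gen_code g))`_i | i <- iota 0 10].
Proof. by move=> bP; rewrite /coords !crd_change // !gen_codeE. Qed.

Lemma coords_basis b g : standard_basis b ->
  coords b (b g) = [seq (i == gen_code g)%N%:R | i <- iota 0 10].
Proof.
by move=> bP; rewrite /coords !(crd_basis bP) -!(inj_eq gen_code_inj) !gen_codeE.
Qed.

Lemma form_coords b u v : standard_basis b -> saa_form u v =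
  \sum_(i < 5) ((coords b u)`_i * (coords b v)`_(i + 5)
              - (coords b u)`_(i + 5) * (coords b v)`_i).
Proof.
have crdE g w : crd b g w = (coords b w)`_(gen_code g).
  by elim/gen_ind: g; rewrite gen_codeE.
by move=> bP; rewrite (form_crd bP); apply: eq_bigr => i _; rewrite !crdE.
Qed.

(** In the order of [flag_triples]: the six entries of the presentation, and
    zero for the nine other triples. *)
Definition presenting_basis b (gamma r s : F) : Prop :=
  flag_basis b /\
  flag_coefs b = [:: gamma; 1; 0; r; s; 0; 0; 1; 1; 0; 0; 0; 0; 0; 0].

Lemma perm_eq_code (s t : seq gen) :
  perm_eq s t = perm_eq (map gen_code s) (map gen_code t).
Proof.
apply/idP/idP => [|st]; first exact: perm_map.
apply/allP => g _ /=; apply/eqP.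
have /permP/(_ (pred1 (gen_code g))) := st; rewrite !count_map /= => e.
rewrite -!(eq_count (a1 := preim gen_code (pred1 (gen_code g)))) // => h /=.
  by rewrite (inj_eq gen_code_inj).
by rewrite (inj_eq gen_code_inj).
Qed.

(** A term of the minor survives on basis vectors only if they are g, h, k in
    some order. *)
Lemma minor3_basis0 b g h k u v w : standard_basis b ->
  ~~ perm_eq [:: u; v; w] [:: g; h; k] ->
  minor3 b g h k (b u) (b v) (b w) = 0.
Proof.
move=> bP nP; rewrite /minor3 !(crd_basis bP).
have nE g' h' k' : perm_eq [:: g'; h'; k'] [:: g; h; k] ->
    (g' == u)%:R * (h' == v)%:R * (k' == w)%:R = 0 :> F.
  move=> p; case: eqP => [gu|_]; last by rewrite !mul0r.
  case: eqP => [hv|_]; last by rewrite mulr0 mul0r.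
  case: eqP => [kw|_]; last by rewrite mulr0.
  by rewrite -gu -hv -kw p in nP.
have := nE g h k (perm_refl _); have := nE g k h; have := nE h g k.
have := nE h k g; have := nE k g h; have := nE k h g.
set a1 := (g == u)%:R; set a2 := (g == v)%:R; set a3 := (g == w)%:R.
set b1 := (h == u)%:R; set b2 := (h == v)%:R; set b3 := (h == w)%:R.
set c1 := (k == u)%:R; set c2 := (k == v)%:R; set c3 := (k == w)%:R.
move=> e1 e2 e3 e4 e5 e6.
transitivity (a1 * b2 * c3 - a1 * c2 * b3 - b1 * a2 * c3 + b1 * c2 * a3
    + c1 * a2 * b3 - c1 * b2 * a3); first by ring.
rewrite e1 ?e2 ?e3 ?e4 ?e5 ?e6; first by ring.
all: by apply/permP => a /=; ring.
Qed.

(** [triple_expand] reduces the vanishing of an unlisted triple to that of the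
    six minors attached to the listed ones. *)
Lemma presenting_basis_presents b gamma r s :
  presenting_basis b gamma r s -> has_presentation L (P10_3_9 gamma r s).
Proof.
case=> bF; case=> c1 c2 c3 c4 c5 c6 c7 c8 c9 d1 d2 d3 d4 d5 d6.
have bP := flag_standard bF.
exists b; split=> // [u v w c | u v w n0].
  by rewrite !inE; do 5?[case/orP]; case/eqP => -> -> -> ->.
rewrite -/(triple (b u) (b v) (b w)) (triple_expand _ _ _ bF) !big_cons big_nil /=.
rewrite c1 c2 c3 c4 c5 c6 c7 c8 c9 d1 d2 d3 d4 d5 d6.
rewrite !mul0r !add0r !addr0 !minor3_basis0 ?mulr0 ?addr0 //.
all: first
  [ by apply: (n0 _ _ _ gamma); rewrite /P10_3_9 !inE ?eqxx ?orbT
  | by apply: (n0 _ _ _ r); rewrite /P10_3_9 !inE ?eqxx ?orbT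
  | by apply: (n0 _ _ _ s); rewrite /P10_3_9 !inE ?eqxx ?orbT
  | by apply: (n0 _ _ _ 1); rewrite /P10_3_9 !inE ?eqxx ?orbT ].
Qed.

(** The presentation speaks of triples of basis vectors; a product of basis
    vectors with an arbitrary vector vanishes by linearity, and comparing
    positions decides which triples are unlisted. *)
Lemma presentation_presenting_basis gamma r s :
  has_presentation L (P10_3_9 gamma r s) ->
  exists b, presenting_basis b gamma r s.
Proof.
case=> b [bP bv b0].
have t0 u v w : all (fun t => ~~ perm_eq (map gen_code [:: u; v; w]) t)
    [:: [:: 1; 8; 9]; [:: 0; 7; 8]; [:: 0; 7; 9]; [:: 0; 6; 8];
        [:: 5; 6; 9]; [:: 5; 7; 8]]%N -> triple (b u) (b v) (b w) = 0.
  move=> uvw; apply: b0 => u' v' w' c; rewrite perm_eq_code.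
  rewrite !inE => in_P; move: uvw => /= /and5P[e1 e2 e3 e4 /and3P[e5 e6 _]].
  by move: in_P; do 5?[case/orP]; case/eqP => -> -> -> _; rewrite /= !gen_codeE.
have ext u v : (forall g, triple u v (b g) = 0) -> forall w, triple u v w = 0.
  move=> uv w; rewrite (crd_span bP w) /triple linear_sumr big1 // => g _.
  by rewrite linearZr_LR /= -/(triple u v (b g)) uv mulr0.
have cen g : (forall h k, triple (b g) (b h) (b k) = 0) ->
    forall v w, triple (b g) v w = 0.
  move=> gC v w; apply: (ext) => k; rewrite -triple_cycle.
  by apply: (ext) => h; rewrite triple_cycle gC.
exists b; split.
  split=> //.
  1-3: by apply: cen => h k; apply: t0;
    elim/gen_ind: h; elim/gen_ind: k; rewrite /= !gen_codeE.
  1-5: by apply: ext => h; apply: t0; elim/gen_ind: h; rewrite /= !gen_codeE.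
  1-2: by apply: t0; rewrite /= !gen_codeE.
have inP u v w c : (u, v, w, c) \in P10_3_9 gamma r s ->
    triple (b u) (b v) (b w) = c.
  exact: bv.
rewrite /flag_coefs /=.
congr [:: _, _, _, _, _, _, _, _, _, _, _, _, _, _ & [:: _]];
  first [by apply: inP; rewrite /P10_3_9 !inE ?eqxx ?orbT
        | by apply: t0; rewrite /= !gen_codeE].
Qed.

Lemma presentationE gamma r s :
  has_presentation L (P10_3_9 gamma r s) <->
  exists b, presenting_basis b gamma r s.
Proof.
split; first exact: presentation_presenting_basis.
by case=> b; apply: presenting_basis_presents.
Qed.
End Presentation.

(** * Normal form of the coefficients *)
Ltac check_symplectic :=
  let i := fresh "i" in let j := fresh "j" in
  let ij := fresh "ij" in let j10 := fresh "j10" in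
  move=> i j /andP[ij j10];
  case: j ij j10 => [|[|[|[|[|[|[|[|[|[|j]]]]]]]]]] // ij _;
  case: i ij => [|[|[|[|[|[|[|[|[|i]]]]]]]]] // _;
  rewrite !big_ord_recl big_ord0 /=.

Ltac expand_triple bF cE :=
  rewrite !(triple_rows _ _ _ bF) cE !(coords_change _ _ (flag_standard bF));
  rewrite ?gen_codeE /row_triple /row_minor /=.

Section Normalise.
Variables (F : fieldType) (L : saa F).
Implicit Types (b : gen -> L).

(** Subtracting multiples of x2 from x1, y1, y2, y3 changes only the value on
    that vector, y4 and y5, by a multiple of gamma; adding al x1 + be y1 to y3
    changes the values on y2, y3, y4 and on y2, y3, y5 independently, because
    x1 y2 = x4 and y1 y2 = x5. The remaining entries restore the standard form
    values, and are central except for the multiples p and q in y2. *)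
Lemma clear_coefs b gamma r s k1 k2 k3 k4 k5 k6 : flag_basis b ->
  flag_coefs b = [:: gamma; 1; 0; r; s; k1; 0; 1; 1; 0; k2; k3; k4; k5; k6] ->
  gamma != 0 -> exists b', presenting_basis b' gamma r s.
Proof.
move=> bF cE g0.
pose p := - (k2 / gamma); pose q := k1 / gamma.
(* The multiples p and q of x1 and y1 in y2, which compensate for the change
   of x1 and y1, pair with y3 and alter the values on y2, y3, y4 and
   y2, y3, y5. *)
pose al := k3 + p * r + q; pose be := k4 + p * s.
pose ep := k5 / gamma; pose ze := (k6 + al * k1 + be * k2) / gamma.
pose A := [::
  [:: 1; - q; - be; 0; 0; 0; 0; 0; 0; 0]; [:: 0; 1; 0; 0; 0; 0; 0; 0; 0; 0];
  [:: 0; 0; 1; 0; 0; 0; 0; 0; 0; 0]; [:: 0; 0; 0; 1; 0; 0; 0; 0; 0; 0];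
  [:: 0; 0; 0; 0; 1; 0; 0; 0; 0; 0];
  [:: 0; p; al; 0; 0; 1; 0; 0; 0; 0];
  [:: p; - ep; q * al - p * be - ze; 0; 0; q; 1; 0; 0; 0];
  [:: al; - ze; 0; 0; 0; be; 0; 1; 0; 0];
  [:: 0; 0; 0; 0; 0; 0; 0; 0; 1; 0]; [:: 0; 0; 0; 0; 0; 0; 0; 0; 0; 1]].
have bP := flag_standard bF.
exists (change_basis b A); split.
  split; first by apply: change_basis_standard => //; check_symplectic; ring.
  1-10: by intros; expand_triple bF cE; ring.
rewrite {1}/flag_coefs /=.
expand_triple bF cE.
by congr [:: _, _, _, _, _, _, _, _, _, _, _, _, _, _ & [:: _]];
  rewrite ?/ze ?/ep ?/al ?/be ?/p ?/q; field; rewrite ?g0.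
Qed.

(** The matrices of phi and psi have rows x1, y1 and columns x4, x5; [delta] is
    det phi, and eta / delta is the x4-coordinate of tau(x5). The new x1, y1,
    x4 are phi^-1(x4), phi^-1(x5) and the image of x5 under nu tau, where nu,
    the factor by which y3 is scaled, is forced by (x1, y1) = 1. *)
Lemma normalise_tau b
    (gamma a24 a25 a34 a35 a45 b24 b25 b34 b35 b45 k1 k2 k3 k4 : F) :
  flag_basis b ->
  flag_coefs b = [:: gamma; a24; a25; a34; a35; a45; b24; b25; b34; b35; b45;
                     k1; k2; k3; k4] ->
  let delta := a24 * b25 - a25 * b24 in
  let eta := a24 * b34 - b24 * a34 in
  let nu := delta ^+ 2 / eta in
  gamma != 0 -> delta != 0 -> eta != 0 ->
  exists b' gamma' k1' k2' k3' k4' k5' k6',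
    [/\ flag_basis b', gamma' != 0 &
    flag_coefs b' =
      [:: gamma'; 1; 0;
          nu * ((b25 * a34 - a25 * b34 - b24 * a35 + a24 * b35) / delta);
          - (nu ^+ 2 * ((a34 * b35 - a35 * b34) / delta)); k1';
          0; 1; 1; 0; k2'; k3'; k4'; k5'; k6']].
Proof.
move=> bF cE delta eta nu g0 delta0 eta0.
(* x5 goes to a multiple of x4 + h x5 under tau. *)
pose h := (a24 * b35 - b24 * a35) / eta.
pose A := [::
  [:: b25 - h * b24; 0; 0; 0; 0; h * a24 - a25; 0; 0; 0; 0];
  [:: 0; 1; 0; 0; 0; 0; 0; 0; 0; 0];
  [:: 0; 0; nu^-1; 0; 0; 0; 0; 0; 0; 0];
  [:: 0; 0; 0; delta; delta * h; 0; 0; 0; 0; 0];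
  [:: 0; 0; 0; 0; 1; 0; 0; 0; 0; 0];
  [:: - (b24 / delta); 0; 0; 0; 0; a24 / delta; 0; 0; 0; 0];
  [:: 0; 0; 0; 0; 0; 0; 1; 0; 0; 0]; [:: 0; 0; 0; 0; 0; 0; 0; nu; 0; 0];
  [:: 0; 0; 0; 0; 0; 0; 0; 0; delta^-1; 0];
  [:: 0; 0; 0; 0; 0; 0; 0; 0; - h; 1]].
have bP := flag_standard bF.
have nu0 : nu != 0 by rewrite mulf_neq0 ?invr_eq0 ?expf_neq0.
have sA : symplectic_rows A.
  by check_symplectic; try ring;
    rewrite /nu /h /delta /eta; field; rewrite -/delta -/eta ?delta0 ?eta0.
exists (change_basis b A), (gamma / delta); do 6!eexists; split; last first.
- rewrite {1}/flag_coefs /=.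
  expand_triple bF cE.
  by congr [:: _, _, _, _, _, _, _, _, _, _, _, _, _, _ & [:: _]];
    rewrite /nu /h /delta /eta; field; rewrite -/delta -/eta ?delta0 ?eta0.
- by rewrite mulf_neq0 ?invr_eq0.
split; first exact: change_basis_standard.
1-10: by intros; expand_triple bF cE; ring.
Qed.
End Normalise.

(** * Adapted bases and the endomorphism tau *)
Section Perp.
Variables (F : fieldType) (L : saa F).
Implicit Types (b : gen -> L) (u v w : L) (U V : {vspace L}).

Lemma form_basis b g h : standard_basis b -> saa_form (b g) (b h) =
  (gen_code h == gen_code g + 5)%N%:R - (gen_code g == gen_code h + 5)%N%:R.
Proof.
have lt (i : 'I_5) k : (nat_of_ord i == k + 5)%N = false.
  by apply/eqP => e; have := ltn_ord i; rewrite e ltnNge leq_addl.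
case=> _ xx yy xy; case: g h => i [] j; rewrite /gen_code ?eqn_add2r ?lt.
- by rewrite xx subrr.
- by rewrite xy (eq_sym (nat_of_ord j)) subr0.
- by rewrite form_antisym xy sub0r (eq_sym (nat_of_ord i)).
- by rewrite yy subrr.
Qed.

Lemma crd_y b i v : crd b (y_ i) v = - saa_form v (b (x_ i)).
Proof. exact: form_antisym. Qed.

Lemma crd_mul_x b i u v : crd b (x_ i) (saa_mul u v) = triple u v (b (y_ i)).
Proof. by []. Qed.

Lemma crd_mul_y b i u v : crd b (y_ i) (saa_mul u v) = - triple u v (b (x_ i)).
Proof. exact: crd_y. Qed.

Definition perp U w : Prop := {in U, forall v, saa_form v w = 0}.

Lemma perp_add U V w : perp U w -> perp V w -> perp (U + V) w.
Proof.
move=> Uw Vw _ /memv_addP[u /Uw u0 [v /Vw v0 ->]].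
by rewrite linearDl /= u0 v0 addr0.
Qed.

Lemma perp_line e w : saa_form e w = 0 -> perp <[e]> w.
Proof. by move=> ew _ /vlineP[k ->]; rewrite linearZl_LR /= ew mulr0. Qed.

Lemma perp_prod U V w :
  {in U & V, forall u v, triple u v w = 0} -> perp (saa_prod U V) w.
Proof.
move=> UV x /(coord_span (X := in_tuple _)) ->; rewrite linear_sumlz big1 // => i _.
rewrite linearZl_LR /= (_ : saa_form _ w = 0) ?mulr0 //.
have : (in_tuple (allpairs (fun a c : L => saa_mul a c) (vbasis U) (vbasis V)))`_i
    \in allpairs (fun a c : L => saa_mul a c) (vbasis U) (vbasis V).
  by rewrite mem_nth.
by case/allpairsP=> -[u v] /= [/vbasis_mem uU /vbasis_mem vV ->]; apply: UV.
Qed.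
End Perp.

Section MinimalPolynomial.
Variables (F : fieldType) (A : 'M[F]_2).

(** The minimal polynomial of a non-scalar 2 x 2 matrix has degree two, hence
    is the characteristic polynomial; an irreducible polynomial of degree two
    has no root. Scalar matrices must be excluded: the minimal polynomial
    X - a is irreducible too, and its linear term is non-zero. *)
Lemma irreducible_mxminpoly2 : irreducible_poly (mxminpoly A) ->
  (forall a, A != a%:M) ->
  (mxminpoly A)`_1 = - \tr A /\
  forall z, z ^+ 2 - \tr A * z + \det A != 0.
Proof.
move=> [sz irr] nscal; have mon := mxminpoly_monic A.
have pE : mxminpoly A = char_poly A.
  have dv := mxminpoly_dvd_char A.
  apply/eqP; rewrite -eqp_monic ?char_poly_monic // -(dvdp_size_eqp dv) eqn_leq.
  rewrite dvdp_leq ?monic_neq0 ?char_poly_monic //= size_char_poly ltnNge.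
  apply/negP => sz2.
  have /eqP {sz2}sz2 : size (mxminpoly A) == 2%N by rewrite eqn_leq sz2.
  have := mx_root_minpoly A; rewrite (_ : mxminpoly A = 'X + ((mxminpoly A)`_0)%:P).
    rewrite rmorphD /= horner_mx_X horner_mx_C => /eqP; rewrite addr_eq0 -rmorphN /=.
    by rewrite (negbTE (nscal _)).
  apply/polyP => i; rewrite coefD coefX coefC.
  case: i => [|[|i]] /=; rewrite ?add0r ?addr0 //.
    by move/monicP: mon; rewrite /lead_coef sz2.
  by rewrite nth_default // sz2.
split=> [|z]; first by rewrite pE char_poly_trace.
apply/negP => /eqP z0.
have : root (char_poly A) z.
  rewrite /root horner_coef size_char_poly !big_ord_recl big_ord0 /=.
  rewrite char_poly_det [(char_poly A)`_1]char_poly_trace //.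
  have /monicP := char_poly_monic A; rewrite /lead_coef size_char_poly /= => lead.
  by apply/eqP; rewrite -[RHS]z0 [(char_poly A)`_(bump _ _)]lead /bump /= !expr2; ring.
rewrite -pE root_factor_theorem => /irr; rewrite size_XsubC => /(_ isT) /eqp_size.
by rewrite size_XsubC pE size_char_poly.
Qed.
End MinimalPolynomial.

Section Adapted.
Variables (F : fieldType) (L : saa F) (b : gen -> L).
Implicit Types (u v w : L) (U V : {vspace L}).
Hypothesis bA : adapted_basis b.
Hypothesis prodL : saa_prod (lcs L 3) (lcs L 2) = lcs L 5.

Let bP : standard_basis b. Proof. by case: bA. Qed.

Let fb g h := form_basis g h bP.

Let l5 : lcs L 5 = (<[b (x_ 5)]> + <[b (x_ 4)]>)%VS.
Proof. by case: bA => _ []. Qed.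
Let zc : saa_center L = (lcs L 5 + <[b (x_ 3)]>)%VS.
Proof. by case: bA => _ []. Qed.
Let u2 : ucs L 2 = lcs L 4.
Proof. by case: bA => _ _ []. Qed.
Let l4 : lcs L 4 = (saa_center L + <[b (x_ 2)]>)%VS.
Proof. by case: bA => _ _ []. Qed.
Let u3 : ucs L 3 = lcs L 3.
Proof. by case: bA => _ _ _ []. Qed.
Let l3 : lcs L 3 = (lcs L 4 + <[b (x_ 1)]> + <[b (y_ 1)]>)%VS.
Proof. by case: bA => _ _ _ []. Qed.
Let l2 : lcs L 2 = (lcs L 3 + <[b (y_ 2)]>)%VS.
Proof. by case: bA => _ _ _ _ []. Qed.
Let u4 : ucs L 4 = (lcs L 3 + <[b (y_ 2)]> + <[b (y_ 3)]>)%VS.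
Proof. by case: bA => _ _ _ _ []. Qed.

(* Each term of a series is spanned by basis vectors, so its orthogonality to a
   basis vector is read off the standard form values. *)
Ltac perp_tac := rewrite ?u4 ?u3 ?u2 ?l2 ?l3 ?l4 ?zc ?l5;
  repeat apply: perp_add; apply: perp_line; rewrite fb !gen_codeE /= ?subrr //.

Let lineU U v : v \in (U + <[v]>)%VS.
Proof. by rewrite (subvP (addvSr _ _)) ?memv_line. Qed.
Let lineL U v w : v \in U -> v \in (U + <[w]>)%VS.
Proof. by apply: (subvP (addvSl _ _)). Qed.

Let x5_l5 : b (x_ 5) \in lcs L 5. Proof. by rewrite l5 lineL ?memv_line. Qed.
Let x4_l5 : b (x_ 4) \in lcs L 5. Proof. by rewrite l5 lineU. Qed.
Let x3_z : b (x_ 3) \in saa_center L. Proof. by rewrite zc lineU. Qed.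
Let x2_l4 : b (x_ 2) \in lcs L 4. Proof. by rewrite l4 lineU. Qed.
Let z_l4 u : u \in saa_center L -> u \in lcs L 4.
Proof. by rewrite l4; apply: lineL. Qed.
Let l5_z u : u \in lcs L 5 -> u \in saa_center L.
Proof. by rewrite zc; apply: lineL. Qed.
Let x1_l3 : b (x_ 1) \in lcs L 3. Proof. by rewrite l3 lineL ?lineU. Qed.
Let y1_l3 : b (y_ 1) \in lcs L 3. Proof. by rewrite l3 lineU. Qed.
Let y2_l2 : b (y_ 2) \in lcs L 2. Proof. by rewrite l2 lineU. Qed.
Let y3_u4 : b (y_ 3) \in ucs L 4. Proof. by rewrite u4 lineU. Qed.

Let center_mul u v w : u \in saa_center L -> triple u v w = 0.
Proof.
move=> uz; have /mem_ucsS/(_ v) : u \in ucs L 1 := uz; rewrite /= memv0 => /eqP uv0.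
by rewrite /triple uv0 linear0l.
Qed.

(** Membership of x2, x1, y3 in Z_2, Z_3, Z_4 puts their products in terms of
    the series that are orthogonal to the remaining argument; the two triples
    through y2, y3 vanish since L^3 L^2 = L^5 is orthogonal to y3. *)
Lemma adapted_flag : flag_basis b.
Proof.
have x2T g u : perp (saa_center L) (b g) -> triple (b (x_ 2)) (b g) u = 0.
  move=> pg; rewrite triple_swapr; apply/eqP; rewrite oppr_eq0; apply/eqP.
  by apply: pg; have := x2_l4; rewrite -u2 => /mem_ucsS/(_ u).
split=> // [u v|u v|u v|u|u|u|u|u||].
- by apply: center_mul.
- by apply/center_mul/l5_z.
- by apply/center_mul/l5_z.
- by apply: x2T; perp_tac.
- by apply: x2T; perp_tac.
- by apply: x2T; perp_tac.
- have p : perp (ucs L 3) (b (x_ 2)) by perp_tac.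
  by rewrite triple_cycle; apply: p; have /mem_ucsS/(_ u) := y3_u4.
- have p : perp (ucs L 2) (b (y_ 1)) by perp_tac.
  rewrite triple_swapr; apply/eqP; rewrite oppr_eq0; apply/eqP/p.
  by have := x1_l3; rewrite -u3 => /mem_ucsS/(_ u).
- have p : perp (lcs L 5) (b (y_ 3)) by perp_tac.
  by apply: p; rewrite -prodL mem_saa_prod.
- have p : perp (lcs L 5) (b (y_ 3)) by perp_tac.
  by apply: p; rewrite -prodL mem_saa_prod.
Qed.

Let bF := adapted_flag.

Section Coefficients.
Variables gamma a24 a25 a34 a35 a45 b24 b25 b34 b35 b45 k1 k2 k3 k4 : F.
Hypothesis cE : flag_coefs b =
    [:: gamma; a24; a25; a34; a35; a45; b24; b25; b34; b35; b45; k1; k2; k3; k4].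

Ltac expand_rows := rewrite (triple_rows _ _ _ bF) cE ?(coords_basis _ bP) ?gen_codeE
  /row_triple /row_minor /=.

(** Otherwise x2 would be central. *)
Lemma adapted_gamma : gamma != 0.
Proof.
apply/eqP => g0; have : b (x_ 2) \in saa_center L.
  suff : b (x_ 2) \in ucs L 1 by []; apply/mem_ucsS => u.
  rewrite /= memv0; apply/eqP/mul_eq0 => w.
  by expand_rows; rewrite g0; ring.
suff z_y2 : perp (saa_center L) (b (y_ 2)).
  by move/z_y2 => /eqP; rewrite fb !gen_codeE /= subr0 oner_eq0.
by perp_tac.
Qed.

Lemma crd_l3 u : u \in lcs L 3 ->
  [/\ crd b (y_ 2) u = 0, crd b (y_ 3) u = 0, crd b (y_ 4) u = 0 &
      crd b (y_ 5) u = 0].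
Proof.
move=> uL; have u0 k : perp (lcs L 3) (b (x_ k)) -> crd b (y_ k) u = 0.
  by move=> pk; rewrite crd_y pk ?oppr0.
by split; apply: u0; perp_tac.
Qed.

Lemma triple_l3_l2 u v p q : u \in lcs L 3 -> v \in lcs L 2 ->
  triple u v (p *: b (y_ 4) + q *: b (y_ 5)) =
  crd b (y_ 2) v * (crd b (x_ 1) u * (a24 * p + a25 * q)
                    + crd b (y_ 1) u * (b24 * p + b25 * q)).
Proof.
move=> uL vL.
have v0 k : perp (lcs L 2) (b (x_ k)) -> crd b (y_ k) v = 0.
  by move=> pk; rewrite crd_y pk ?oppr0.
have [uy2 uy3 uy4 uy5] := crd_l3 uL.
have [vy3 vy4 vy5] : [/\ crd b (y_ 3) v = 0, crd b (y_ 4) v = 0 &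
    crd b (y_ 5) v = 0].
  by split; apply: v0; perp_tac.
expand_rows; rewrite uy2 uy3 uy4 uy5 vy3 vy4 vy5 !crdD !crdZ !(crd_basis bP).
by rewrite -!(inj_eq gen_code_inj) !gen_codeE /=; ring.
Qed.

(** A combination of y4 and y5 killed by the matrix of phi is orthogonal to
    L^3 L^2, hence to x4 and x5 in L^5, hence zero. *)
Lemma adapted_delta : a24 * b25 - a25 * b24 != 0.
Proof.
apply/eqP => delta0.
have ker p q : a24 * p + a25 * q = 0 -> b24 * p + b25 * q = 0 -> p = 0 /\ q = 0.
  move=> ea eb; have pw : perp (lcs L 5) (p *: b (y_ 4) + q *: b (y_ 5)).
    rewrite -prodL; apply: perp_prod => u v uL vL.
    by rewrite triple_l3_l2 // ea eb; ring.
  have := pw _ x4_l5; have := pw _ x5_l5.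
  rewrite !linearDr /= !linearZr_LR /= !fb !gen_codeE /=.
  by rewrite !subr0 !mulr0 !mulr1 add0r addr0 => -> ->.
(* If the determinant vanishes, each row is orthogonal to both turned rows. *)
have [] := ker (- a25) a24 _ _; [by ring | by rewrite -[RHS]delta0; ring|].
move=> /eqP; rewrite oppr_eq0 => /eqP a25_0 a24_0.
have [] := ker (- b25) b24 _ _; [by rewrite a25_0 a24_0; ring | by ring |].
move=> /eqP; rewrite oppr_eq0 => /eqP b25_0 b24_0.
have [] := ker 1 0; rewrite ?a24_0 ?a25_0 ?b24_0 ?b25_0; try by ring.
by move=> /eqP; rewrite oner_eq0.
Qed.

Let delta := a24 * b25 - a25 * b24.
Let delta0 : delta != 0 := adapted_delta.

Lemma mul_l3_y2 u : u \in lcs L 3 -> saa_mul u (b (y_ 2)) =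
  (crd b (x_ 1) u * a24 + crd b (y_ 1) u * b24) *: b (x_ 4) +
  (crd b (x_ 1) u * a25 + crd b (y_ 1) u * b25) *: b (x_ 5).
Proof.
move=> /crd_l3[uy2 uy3 uy4 uy5]; apply: (crd_ext bP).
by elim/gen_ind; rewrite crdD !crdZ !(crd_basis bP) -!(inj_eq gen_code_inj)
  !gen_codeE ?crd_mul_x ?crd_mul_y; expand_rows; rewrite uy2 uy3 uy4 uy5; ring.
Qed.

Lemma mul_l3_y3 u : u \in lcs L 3 -> saa_mul u (b (y_ 3)) =
  (crd b (x_ 1) u * a34 + crd b (y_ 1) u * b34) *: b (x_ 4) +
  (crd b (x_ 1) u * a35 + crd b (y_ 1) u * b35) *: b (x_ 5).
Proof.
move=> /crd_l3[uy2 uy3 uy4 uy5]; apply: (crd_ext bP).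
by elim/gen_ind; rewrite crdD !crdZ !(crd_basis bP) -!(inj_eq gen_code_inj)
  !gen_codeE ?crd_mul_x ?crd_mul_y; expand_rows; rewrite uy2 uy3 uy4 uy5; ring.
Qed.

(** Any u in L^3 with u y2 = p x4 + q x5 serves as a value of phi^-1, since
    u y2 and u y3 depend on the same two coordinates of u; the equation
    u y2 = p x4 + q x5 gives these by the inverse of the matrix of phi. *)
Lemma tau_l5 p q : tau b (p *: b (x_ 4) + q *: b (x_ 5)) =
  ((p * b25 - q * b24) / delta * a34 + (q * a24 - p * a25) / delta * b34)
    *: b (x_ 4) +
  ((p * b25 - q * b24) / delta * a35 + (q * a24 - p * a25) / delta * b35)
    *: b (x_ 5).
Proof.
set e := p *: _ + _.
have phiE t : phi b t = saa_mul (vsval t) (b (y_ 2)).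
  by rewrite comp_lfunE lfunE saa_mulrE.
have psiE t : psi b t = saa_mul (vsval t) (b (y_ 3)).
  by rewrite comp_lfunE lfunE saa_mulrE.
have e_im : e \in limg (phi b).
  pose u := ((p * b25 - q * b24) / delta) *: b (x_ 1) +
            ((q * a24 - p * a25) / delta) *: b (y_ 1).
  have uL : u \in lcs L 3 by rewrite memvD ?memvZ.
  have <- : phi b (vsproj (lcs L 3) u) = e; last by rewrite memv_img ?memvf.
  rewrite phiE vsprojK // mul_l3_y2 // !crdD !crdZ !(crd_basis bP).
  rewrite -!(inj_eq gen_code_inj) !gen_codeE /= !mulr0 !mulr1 addr0 add0r /e.
  by congr (_ *: _ + _ *: _); rewrite /delta; field; rewrite -/delta delta0.
have := limg_lfunVK e_im; rewrite phiE.
rewrite comp_lfunE psiE; set u := vsval _; have uL : u \in lcs L 3 by apply: subvsP.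
rewrite mul_l3_y2 // mul_l3_y3 // => ue.
have e4 := congr1 (crd b (x_ 4)) ue; have e5 := congr1 (crd b (x_ 5)) ue.
move: e4 e5; rewrite !crdD !crdZ !(crd_basis bP) -!(inj_eq gen_code_inj) !gen_codeE /=.
rewrite !mulr0 !mulr1 !addr0 !add0r => e4 e5.
by congr (_ *: _ + _ *: _); rewrite -e4 -e5 /delta; field; rewrite -/delta delta0.
Qed.

(** Rows and columns follow the order x5, x4 of [L5_basis]. *)
Lemma tau_mxE : tau_mx b = \matrix_(i, j)
  (nth [::] [:: [:: (a24 * b35 - b24 * a35) / delta;
                    (a24 * b34 - b24 * a34) / delta];
                [:: (b25 * a35 - a25 * b35) / delta;
                    (b25 * a34 - a25 * b34) / delta]] i)`_j.
Proof.
have free5 : free (L5_basis b).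
  apply/freeP => k k0 i; move: k0; rewrite !big_ord_recl big_ord0 addr0 /= => k0.
  have := congr1 (crd b (x_ 4)) k0; have := congr1 (crd b (x_ 5)) k0.
  rewrite !crdD !crdZ !(crd_basis bP) -!(inj_eq gen_code_inj) !gen_codeE /=.
  rewrite !crd0 !mulr1 !mulr0 addr0 add0r => k0_0 k1_0.
  case: i => [[|[|i]]] //= h; [rewrite -k0_0 | rewrite -k1_0];
    by congr (k _); apply: val_inj.
have l5E p q : p *: b (x_ 4) + q *: b (x_ 5) =
    \sum_(j < 2) [:: q; p]`_j *: (L5_basis b)`_j.
  by rewrite !big_ord_recl big_ord0 /= addr0 addrC.
apply/matrixP => i j; rewrite !mxE.
have -> : tnth (L5_basis b) i =
    [:: 0; 1]`_i *: b (x_ 4) + [:: 1; 0]`_i *: b (x_ 5).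
  case: i => [[|[|i]]] //= h; rewrite (tnth_nth 0) /= !scale0r scale1r;
    by rewrite ?addr0 ?add0r.
rewrite tau_l5 l5E coord_sum_free //.
by case: i => [[|[|i]]] //= _; case: j => [[|[|j]]] //= _;
  field; rewrite delta0.
Qed.

(** If tau = a, then z = y3 - a y2 annihilates x1 and y1 as well as L^4, so
    that zL is orthogonal to L^3, hence in Z_2, and z is in Z_3 = L^3; but
    elements of L^3 have no coordinate along y3. *)
Lemma tau_not_scalar a : tau_mx b != a%:M.
Proof.
apply/eqP => tauE.
have [t00 t01 t10 t11] : [/\ (a24 * b35 - b24 * a35) / delta = a,
    (a24 * b34 - b24 * a34) / delta = 0,
    (b25 * a35 - a25 * b35) / delta = 0 &
    (b25 * a34 - a25 * b34) / delta = a].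
  have tE i j := congr1 (fun M : 'M_2 => M i j) tauE.
  have := tE 0 0; have := tE 0 1; have := tE 1 0; have := tE 1 1.
  by rewrite tau_mxE !mxE /= => -> -> -> ->.
have [a34E b34E a35E b35E] :
    [/\ a34 = a * a24, b34 = a * b24, a35 = a * a25 & b35 = a * b25].
  split; apply: (mulfI delta0).
  - transitivity (delta * (a24 * ((b25 * a34 - a25 * b34) / delta)
                           + a25 * ((a24 * b34 - b24 * a34) / delta))).
      by rewrite /delta; field; rewrite -/delta delta0.
    by rewrite t11 t01; ring.
  - transitivity (delta * (b24 * ((b25 * a34 - a25 * b34) / delta)
                           + b25 * ((a24 * b34 - b24 * a34) / delta))).
      by rewrite /delta; field; rewrite -/delta delta0.
    by rewrite t11 t01; ring.
  - transitivity (delta * (a25 * ((a24 * b35 - b24 * a35) / delta)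
                           + a24 * ((b25 * a35 - a25 * b35) / delta))).
      by rewrite /delta; field; rewrite -/delta delta0.
    by rewrite t00 t10; ring.
  - transitivity (delta * (b25 * ((a24 * b35 - b24 * a35) / delta)
                           + b24 * ((b25 * a35 - a25 * b35) / delta))).
      by rewrite /delta; field; rewrite -/delta delta0.
    by rewrite t00 t10; ring.
pose z := b (y_ 3) - a *: b (y_ 2).
have zE g : crd b g z = (g == y_ 3)%:R - a * (g == y_ 2)%:R.
  by rewrite /z -scaleNr crdD crdZ !(crd_basis bP) mulNr.
have zT g v : g \in [:: x_ 1; x_ 2; x_ 3; x_ 4; x_ 5; y_ 1] -> triple z v (b g) = 0.
  rewrite !inE; do 5?[case/orP]; move/eqP => ->;
  by expand_rows; rewrite !zE -!(inj_eq gen_code_inj) !gen_codeE /=;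
    rewrite ?a34E ?b34E ?a35E ?b35E; ring.
have : z \in ucs L 3.
  apply/mem_ucsS => v; rewrite u2 (crd_span bP (saa_mul z v)) gen_span.
  rewrite !crd_mul_x !crd_mul_y.
  rewrite (zT (y_ 1)) ?inE ?eqxx ?orbT // (zT (x_ 1)) ?inE ?eqxx ?orbT //
    (zT (x_ 2)) ?inE ?eqxx ?orbT // (zT (x_ 3)) ?inE ?eqxx ?orbT //
    (zT (x_ 4)) ?inE ?eqxx ?orbT // (zT (x_ 5)) ?inE ?eqxx ?orbT //.
  rewrite !oppr0 !scale0r !add0r.
  by rewrite !memvD // memvZ // ?z_l4 // l5_z.
rewrite u3 => /crd_l3[_ + _ _]; rewrite zE -!(inj_eq gen_code_inj) !gen_codeE /=.
by move/eqP; rewrite mulr0 subr0 oner_eq0.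
Qed.

End Coefficients.
End Adapted.

Lemma quadratic_irreducible (F : fieldType) (r s : F) :
  (forall z, z ^+ 2 + r * z + s != 0) -> irreducible_poly (quadratic r s).
Proof.
move=> nroot.
have qE : quadratic r s = 'X^2 + (r *: 'X + s%:P) by rewrite /quadratic -addrA.
have sz : size (quadratic r s) = 3%N.
  rewrite qE size_polyDl size_polyXn // ltnS (leq_trans (size_polyD _ _)) // geq_max.
  rewrite (leq_trans (size_scale_leq _ _)) ?size_polyX //.
  by rewrite (leq_trans (size_polyC_leq1 _)).
apply: cubic_irreducible; first by rewrite sz.
by move=> z; rewrite /root /quadratic !hornerE nroot.
Qed.

Lemma det_mx22 (R : comNzRingType) (A : 'M[R]_2) :
  \det A = A 0 0 * A 1 1 - A 0 1 * A 1 0.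
Proof.
rewrite (expand_det_row A 0) !big_ord_recl big_ord0 /cofactor !det_mx11 !mxE /=.
rewrite addr0 expr0 mul1r expr1 mulN1r mulrN.
by congr (_ * A _ _ - A _ _ * A _ _); apply: val_inj.
Qed.

(** In characteristic 2 the quadratic of the presentation is
    t^2 - nu tr(tau) t + nu^2 det(tau), whose roots are nu times the
    eigenvalues of tau. *)
Lemma adapted_presentation (F : fieldType) (charF2 : 2%N \in [pchar F]) (L : saa F) :
  saa_prod (lcs L 3) (lcs L 2) = lcs L 5 ->
  type_C_nonzero_linear_term L ->
  exists gamma r s : F,
    admissible gamma r s /\ has_presentation L (P10_3_9 gamma r s).
Proof.
move=> prodL [b [bA irr lin]].
have bF := adapted_flag bA prodL.
have [gamma [a24 [a25 [a34 [a35 [a45 [b24 [b25 [b34 [b35 [b45 [k1 [k2 [k3 [k4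
    cE]]]]]]]]]]]]]]] :
  exists gamma a24 a25 a34 a35 a45 b24 b25 b34 b35 b45 k1 k2 k3 k4,
    flag_coefs b = [:: gamma; a24; a25; a34; a35; a45; b24; b25; b34; b35; b45;
                       k1; k2; k3; k4].
  by do 15!eexists.
have g0 := adapted_gamma bA prodL cE; have delta0 := adapted_delta bA prodL cE.
have [lin1 nroot] := irreducible_mxminpoly2 irr (tau_not_scalar bA prodL cE).
have trE : \tr (tau_mx b) =
    (b25 * a34 - a25 * b34 - b24 * a35 + a24 * b35) / (a24 * b25 - a25 * b24).
  rewrite (tau_mxE bA prodL cE) /mxtrace !big_ord_recl big_ord0 !mxE /=.
  by field; rewrite delta0.
have detE : \det (tau_mx b) = (a34 * b35 - a35 * b34) / (a24 * b25 - a25 * b24).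
  rewrite (tau_mxE bA prodL cE) det_mx22 !mxE /=.
  by field; rewrite delta0.
(* Otherwise x5 is an eigenvector of tau, with the eigenvalue below. *)
have eta0 : a24 * b34 - b24 * a34 != 0.
  apply/eqP => eta0.
  have /eqP[] := nroot ((a24 * b35 - b24 * a35) / (a24 * b25 - a25 * b24)).
  have := tau_mxE bA prodL cE; set M := \matrix_(i, j) _ => ->.
  rewrite det_mx22 /mxtrace !big_ord_recl big_ord0 !mxE /= eta0.
  by ring.
have [b' [gamma' [l1 [l2 [l3 [l4 [l5 [l6]]]]]]]] :=
  normalise_tau bF cE g0 delta0 eta0.
rewrite -trE -detE; set nu := _ / _ => -[bF' g0' cE'].
have nu0 : nu != 0 by rewrite mulf_neq0 ?invr_eq0 ?expf_neq0.
exists gamma', (nu * \tr (tau_mx b)), (- (nu ^+ 2 * \det (tau_mx b))); split.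
  split=> //; first by rewrite mulf_neq0 // -oppr_eq0 -lin1.
  apply: quadratic_irreducible => z; have := nroot (z / nu).
  have two0 : 2 = 0 :> F := pcharf0 charF2.
  apply: contra => /eqP z0; rewrite -(mulrI_eq0 _ (lregX (n := 2) (mulfI nu0))).
  apply/eqP; rewrite -[RHS]z0; set t := \tr _; set d := \det _.
  transitivity (z ^+ 2 + nu * t * z - nu ^+ 2 * d + 2 * (nu ^+ 2 * d - nu * t * z)).
    by field; rewrite nu0.
  by rewrite two0 mul0r addr0.
apply/presentationE.
by apply: clear_coefs bF' cE' g0'.
Qed.

(** * Isomorphisms and presentations *)
Section Transport.
Variables (F : fieldType).
Implicit Types (L : saa F).

Definition transfer L L' (b : gen -> L) (b' : gen -> L') : 'Hom(L', L) :=
  linfun (fun v => \sum_g crd b' g v *: b g).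

Lemma transferE L L' (b : gen -> L) (b' : gen -> L') v :
  transfer b b' v = \sum_g crd b' g v *: b g.
Proof.
have lin : linear (fun v => \sum_g crd b' g v *: b g).
  move=> a u w; rewrite scaler_sumr -big_split; apply: eq_bigr => g _ /=.
  by rewrite crdD crdZ scalerDl scalerA.
pose g := GRing.isLinear.Build F L' L *:%R _ lin.
by rewrite (lfunE (HB.pack_for {linear L' -> L}
                     (fun v => \sum_g crd b' g v *: b g) g)).
Qed.

Lemma crd_transfer L L' (b : gen -> L) (b' : gen -> L') g v :
  standard_basis b -> crd b g (transfer b b' v) = crd b' g v.
Proof. by move=> bP; rewrite transferE crd_combination. Qed.

(** The linear map matching the two bases preserves the form and T, which are
    the same polynomials in coordinates; non-degeneracy gives the product. *)
Lemma presenting_iso L L' (b : gen -> L) (b' : gen -> L') gamma r s :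
  presenting_basis b gamma r s -> presenting_basis b' gamma r s -> saa_iso L' L.
Proof.
move=> [bF cE] [bF' cE'].
have bP := flag_standard bF; have bP' := flag_standard bF'.
have can (M M' : saa F) (c : gen -> M) (c' : gen -> M') :
    standard_basis c -> standard_basis c' ->
    cancel (transfer c c') (transfer c' c).
  by move=> cP cP' v; apply: (crd_ext cP') => g; rewrite !crd_transfer.
have formE u v : saa_form (transfer b b' u) (transfer b b' v) = saa_form u v.
  rewrite (form_crd bP) (form_crd bP'); apply: eq_bigr => i _.
  by rewrite !crd_transfer.
exists (transfer b b'); split=> // [|u v].
  by exists (transfer b' b); apply: can.
apply: form_ext => w; rewrite -(can _ _ b' b bP' bP w) formE.
rewrite -/(triple u v _) -/(triple _ _ _) (triple_rows _ _ _ bF) cE.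
rewrite (triple_rows _ _ _ bF') cE'.
by rewrite /coords !crd_transfer.
Qed.

Lemma has_presentation_iso L L' P : \dim {:L} = 10%N ->
  saa_iso L' L -> has_presentation L' P -> has_presentation L P.
Proof.
move=> dimL [f [_ ff fm]] [b [[_ xx yy xy] vals zeros]].
exists (f \o b); split=> [|u v w c /vals|u v w /zeros]; rewrite /= -?fm ?ff //.
by apply: standard_form_basis => //; split=> i j; rewrite /= ff.
Qed.
End Transport.

Section Rescale.
Variables (F : fieldType) (L : saa F).

(** The vectors are those dictated by y2' = a y2, y3' = a (d y3 + e y2) and
    x5' = l x4 + k x5: x4' = m x4 + n x5 is the image of x5' under d tau + e,
    y4' and y5' are dual to x4' and x5', and x1', y1' are the preimages of x4',
    x5' under phi' = a phi. The choice of d makes (x1', y1') = 1. *)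
Lemma rescale_presentation (b : gen -> L) (gamma r s a k l e : F) :
  presenting_basis b gamma r s -> a != 0 ->
  let G := k ^+ 2 + r * k * l - s * l ^+ 2 in G != 0 -> let d := a ^+ 2 / G in
  exists b' : gen -> L, presenting_basis b' (gamma / a ^+ 3) (d * r + 2 * e)
    (d ^+ 2 * s - d * e * r - e ^+ 2).
Proof.
move=> [bF cE] a0 G G0 d.
pose m := d * (l * r + k) + e * l; pose n := d * (l * s) + e * k.
pose A := [::
  [:: m / a; 0; 0; 0; 0; n / a; 0; 0; 0; 0];
  [:: 0; a^-1; - (e / (a * d)); 0; 0; 0; 0; 0; 0; 0];
  [:: 0; 0; (a * d)^-1; 0; 0; 0; 0; 0; 0; 0];
  [:: 0; 0; 0; m; n; 0; 0; 0; 0; 0];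
  [:: 0; 0; 0; l; k; 0; 0; 0; 0; 0];
  [:: l / a; 0; 0; 0; 0; k / a; 0; 0; 0; 0];
  [:: 0; 0; 0; 0; 0; 0; a; 0; 0; 0];
  [:: 0; 0; 0; 0; 0; 0; a * e; a * d; 0; 0];
  [:: 0; 0; 0; 0; 0; 0; 0; 0; k / a ^+ 2; - (l / a ^+ 2)];
  [:: 0; 0; 0; 0; 0; 0; 0; 0; - (n / a ^+ 2); m / a ^+ 2]].
have bP := flag_standard bF.
exists (change_basis b A); split.
  split.
    by apply: change_basis_standard => //; check_symplectic; try ring;
      rewrite /m /n /d /G; field; rewrite -/G ?G0 ?a0.
  1-10: by intros; expand_triple bF cE; ring.
rewrite {1}/flag_coefs /=.
expand_triple bF cE.
by congr [:: _, _, _, _, _, _, _, _, _, _, _, _, _, _ & [:: _]];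
  rewrite /m /n /d /G; field; rewrite -/G ?G0 ?a0.
Qed.
End Rescale.

(** * The lower central series of a presented algebra *)

(** The coordinates vanishing on a term of the lower central series, and the
    basis vectors lying in it, relate two presenting bases of one algebra. *)
Section Invariants.
Variables (F : fieldType) (L : saa F) (b : gen -> L) (gamma r s : F).
Hypotheses (bG : presenting_basis b gamma r s) (g0 : gamma != 0).
Implicit Types u v w : L.

Let bF : flag_basis b. Proof. by case: bG. Qed.
Let cE : flag_coefs b = [:: gamma; 1; 0; r; s; 0; 0; 1; 1; 0; 0; 0; 0; 0; 0].
Proof. by case: bG. Qed.
Let bP := flag_standard bF.

Ltac row_tac :=
  rewrite (triple_rows _ _ _ bF) cE ?(coords_basis _ bP) ?gen_codeE
    /row_triple /row_minor /=.

Ltac mul_tac :=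
  apply: (crd_ext bP); elim/gen_ind;
  rewrite ?crdD !crdZ !(crd_basis bP) -!(inj_eq gen_code_inj) !gen_codeE
    ?crd_mul_x ?crd_mul_y; row_tac; ring.

Lemma mul_x1y2 : saa_mul (b (x_ 1)) (b (y_ 2)) = 1 *: b (x_ 4).
Proof. mul_tac. Qed.
Lemma mul_y1y2 : saa_mul (b (y_ 1)) (b (y_ 2)) = 1 *: b (x_ 5).
Proof. mul_tac. Qed.
Lemma mul_y1y3 : saa_mul (b (y_ 1)) (b (y_ 3)) = 1 *: b (x_ 4).
Proof. mul_tac. Qed.
Lemma mul_x1y3 : saa_mul (b (x_ 1)) (b (y_ 3)) = r *: b (x_ 4) + s *: b (x_ 5).
Proof. mul_tac. Qed.

Let mul_y4y5 : saa_mul (b (y_ 4)) (b (y_ 5)) = - gamma *: b (y_ 2).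
Proof. mul_tac. Qed.
Let mul_y2y5 : saa_mul (b (y_ 2)) (b (y_ 5)) = 1 *: b (x_ 1).
Proof. mul_tac. Qed.
Let mul_y2y4 : saa_mul (b (y_ 2)) (b (y_ 4)) = -1 *: b (y_ 1).
Proof. mul_tac. Qed.
Let mul_y1y5 : saa_mul (b (y_ 1)) (b (y_ 5)) = -1 *: b (x_ 2).
Proof. mul_tac. Qed.
Let mul_x2y4 : saa_mul (b (x_ 2)) (b (y_ 4)) = gamma *: b (x_ 5).
Proof. mul_tac. Qed.
Let mul_x2y5 : saa_mul (b (x_ 2)) (b (y_ 5)) = - gamma *: b (x_ 4).
Proof. mul_tac. Qed.

Let mem_lcs k u v c w : u \in lcs L k.+1 -> saa_mul u v = c *: w -> c != 0 ->
  w \in lcs L k.+2.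
Proof.
move=> uk uv c0; rewrite -(scale1r w) -(mulVf c0) -scalerA -uv memvZ //.
by apply: mem_saa_prod; rewrite ?memvf.
Qed.

Let ng0 : - gamma != 0. Proof. by rewrite oppr_eq0. Qed.
Let n10 : -1 != 0 :> F. Proof. by rewrite oppr_eq0 oner_eq0. Qed.

Lemma y2_lcs2 : b (y_ 2) \in lcs L 2.
Proof. exact: (mem_lcs (k := 0)) (memvf _) mul_y4y5 ng0. Qed.
Lemma x1_lcs3 : b (x_ 1) \in lcs L 3.
Proof. exact: mem_lcs y2_lcs2 mul_y2y5 (oner_neq0 F). Qed.
Lemma y1_lcs3 : b (y_ 1) \in lcs L 3.
Proof. exact: mem_lcs y2_lcs2 mul_y2y4 n10. Qed.
Lemma x2_lcs4 : b (x_ 2) \in lcs L 4.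
Proof. exact: mem_lcs y1_lcs3 mul_y1y5 n10. Qed.
Lemma x4_lcs5 : b (x_ 4) \in lcs L 5.
Proof. exact: mem_lcs x2_lcs4 mul_x2y5 ng0. Qed.
Lemma x5_lcs5 : b (x_ 5) \in lcs L 5.
Proof. exact: mem_lcs x2_lcs4 mul_x2y4 g0. Qed.

Let crd_y_perp k i : perp (lcs L k) (b (x_ i)) ->
  {in lcs L k, forall u, crd b (y_ i) u = 0}.
Proof.
by move=> p u /p e; rewrite crd_y e oppr0.
Qed.

(** Each term of the series is spanned by products uv with u in the previous
    term, where T(u, v, w) = 0 for more and more basis vectors w. *)
Lemma crd_lcs2 u : u \in lcs L 2 ->
  [/\ crd b (y_ 3) u = 0, crd b (y_ 4) u = 0 & crd b (y_ 5) u = 0].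
Proof.
move=> u2; split; (apply: crd_y_perp u2; apply: perp_prod => v w _ _;
  row_tac; ring).
Qed.

Lemma crd_lcs3 u : u \in lcs L 3 ->
  [/\ crd b (y_ 2) u = 0, crd b (y_ 3) u = 0, crd b (y_ 4) u = 0 &
      crd b (y_ 5) u = 0].
Proof.
move=> u3; split; (apply: crd_y_perp u3;
  apply: perp_prod => v w /crd_lcs2[v3 v4 v5] _; row_tac; rewrite v3 v4 v5; ring).
Qed.

Lemma crd_lcs4 u : u \in lcs L 4 ->
  [/\ crd b (x_ 1) u = 0, crd b (y_ 1) u = 0 &
  [/\ crd b (y_ 2) u = 0, crd b (y_ 3) u = 0, crd b (y_ 4) u = 0 &
      crd b (y_ 5) u = 0]].
Proof.
move=> u4; split; last split.
1: apply: (_ : perp (lcs L 4) (b (y_ 1))) u4;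
  apply: perp_prod => v w /crd_lcs3[v2 v3 v4 v5] _;
  row_tac; rewrite v2 v3 v4 v5; ring.
all: apply: crd_y_perp u4; apply: perp_prod => v w /crd_lcs3[v2 v3 v4 v5] _;
  row_tac; rewrite v2 v3 v4 v5; ring.
Qed.

Lemma crd_lcs5 u : u \in lcs L 5 ->
  exists p q, coords b u = [:: 0; 0; 0; p; q; 0; 0; 0; 0; 0].
Proof.
move=> u5; exists (crd b (x_ 4) u), (crd b (x_ 5) u); rewrite /coords.
have e k : perp (lcs L 5) (b (x_ k)) -> crd b (y_ k) u = 0.
  by move/crd_y_perp; apply.
have e' k : perp (lcs L 5) (b (y_ k)) -> crd b (x_ k) u = 0 by apply.
congr [:: _, _, _, _, _, _, _, _, _ & [:: _]].
1-3: apply: e'.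
4-8: apply: e.
all: apply: perp_prod => v w /crd_lcs4[v1 v1' [v2 v3 v4 v5]] _;
  row_tac; rewrite v1 v1' v2 v3 v4 v5; ring.
Qed.
End Invariants.

(** * Comparison of two presentations of one algebra *)

(** The elimination behind [compare_presentations]. The hypotheses are the
    coordinates along x4, x5 of x1' y2' = x4', y1' y2' = x5', y1' y3' = x4' and
    x1' y3' = r' x4' + s' x5', with (x1', y1') = 1 in between. The last two are
    linear equations for r' and s' of determinant m k - n l = a^2, solved by
    Cramer's rule. *)
Lemma parameters_of_change (F : fieldType)
    (r s r' s' a k l m n d3 e2 al be al' be' : F) :
  a != 0 -> al * a = m -> be * a = n -> al' * a = l -> be' * a = k ->
  al * be' - be * al' = 1 ->
  al' * (e2 * 1 + d3 * r) + be' * d3 = m ->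
  al' * (d3 * s) + be' * e2 = n ->
  al * (e2 + d3 * r) + be * d3 = r' * m + s' * l ->
  al * (d3 * s) + be * e2 = r' * n + s' * k ->
  let d := d3 / a in let e := e2 / a in
  [/\ m * k - n * l = a ^+ 2, d * (k ^+ 2 + r * k * l - s * l ^+ 2) = a ^+ 2,
     r' = d * r + 2 * e & s' = d ^+ 2 * s - d * e * r - e ^+ 2].
Proof.
move=> a0 mE nE lE kE wE e1 e2' e3 e4 d e.
have mkE : m * k - n * l = a ^+ 2.
  by rewrite -mE -nE -lE -kE -[RHS]mulr1 -wE; ring.
have det0 : m * k - n * l != 0 by rewrite mkE expf_neq0.
have dE : d3 = d * a by rewrite mulfVK.
have eE : e2 = e * a by rewrite mulfVK.
have m' : m = d * (l * r + k) + e * l.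
  by rewrite -e1 dE eE -lE -kE; ring.
have n' : n = d * (l * s) + e * k.
  by rewrite -e2' dE eE -lE -kE; ring.
have GE : d * (k ^+ 2 + r * k * l - s * l ^+ 2) = a ^+ 2.
  by rewrite -mkE m' n'; ring.
have e3' : d * (m * r + n) + e * m = r' * m + s' * l.
  by rewrite -e3 dE eE -mE -nE; ring.
have e4' : d * (m * s) + e * n = r' * n + s' * k.
  by rewrite -e4 dE eE -mE -nE; ring.
split=> //; apply: (mulIf det0).
  transitivity ((r' * m + s' * l) * k - (r' * n + s' * k) * l); first by ring.
  by rewrite -e3' -e4' m' n'; ring.
transitivity ((r' * n + s' * k) * m - (r' * m + s' * l) * n); first by ring.
by rewrite -e3' -e4' m' n'; ring.
Qed.

(** Besides [parameters_of_change], which only concerns the products of x1, y1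
    with y2, y3: (x2', y2') = 1 makes x2' equal to x2 / a modulo the centre,
    and duality makes y4', y5' transform by the inverse of the matrix of
    determinant a^2 taking x4, x5 to x4', x5'; so T(x2', y4', y5') is
    gamma / a^3. *)
Lemma compare_presentations (F : fieldType) (L : saa F) (b b' : gen -> L)
    (gamma r s gamma' r' s' : F) :
  presenting_basis b gamma r s -> presenting_basis b' gamma' r' s' ->
  gamma != 0 -> gamma' != 0 ->
  exists a k l d e : F, [/\ a != 0, gamma' * a ^+ 3 = gamma,
    d * (k ^+ 2 + r * k * l - s * l ^+ 2) = a ^+ 2,
    r' = d * r + 2 * e & s' = d ^+ 2 * s - d * e * r - e ^+ 2].
Proof.
move=> bG bG' g0 g0'.
have [[bF cE] [bF' cE']] := (bG, bG').
have bP := flag_standard bF; have bP' := flag_standard bF'.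
have [m [n x4E]] := crd_lcs5 bG (x4_lcs5 bG' g0').
have [l [k x5E]] := crd_lcs5 bG (x5_lcs5 bG' g0').
have [x2x1 x2y1 [x2y2 x2y3 x2y4 x2y5]] := crd_lcs4 bG (x2_lcs4 bG' g0').
have [x1y2 x1y3 x1y4 x1y5] := crd_lcs3 bG (x1_lcs3 bG' g0').
have [y1y2 y1y3 y1y4 y1y5] := crd_lcs3 bG (y1_lcs3 bG' g0').
have [y2y3 y2y4 y2y5] := crd_lcs2 bG (y2_lcs2 bG' g0').
have formE g h := form_basis g h bP'.
have form5 u v := form_coords u v bP.
pose p4 := crd b (y_ 4) (b' (y_ 4)); pose q4 := crd b (y_ 5) (b' (y_ 4)).
pose p5 := crd b (y_ 4) (b' (y_ 5)); pose q5 := crd b (y_ 5) (b' (y_ 5)).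
have x4y4 : m * p4 + n * q4 = 1.
  transitivity (saa_form (b' (x_ 4)) (b' (y_ 4))); last first.
    by rewrite formE !gen_codeE /= subr0.
  by rewrite form5 !big_ord_recl big_ord0 x4E /= /p4 /q4; ring.
have x4y5 : m * p5 + n * q5 = 0.
  transitivity (saa_form (b' (x_ 4)) (b' (y_ 5))); last first.
    by rewrite formE !gen_codeE /= subr0.
  by rewrite form5 !big_ord_recl big_ord0 x4E /= /p5 /q5; ring.
have x5y4 : l * p4 + k * q4 = 0.
  transitivity (saa_form (b' (x_ 5)) (b' (y_ 4))); last first.
    by rewrite formE !gen_codeE /= subr0.
  by rewrite form5 !big_ord_recl big_ord0 x5E /= /p4 /q4; ring.
have x5y5 : l * p5 + k * q5 = 1.
  transitivity (saa_form (b' (x_ 5)) (b' (y_ 5))); last first.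
    by rewrite formE !gen_codeE /= subr0.
  by rewrite form5 !big_ord_recl big_ord0 x5E /= /p5 /q5; ring.
have det1 : (m * k - n * l) * (p4 * q5 - q4 * p5) = 1.
  transitivity ((m * p4 + n * q4) * (l * p5 + k * q5)
                - (m * p5 + n * q5) * (l * p4 + k * q4)).
    by ring.
  by rewrite x4y4 x4y5 x5y5; ring.
have det0 : m * k - n * l != 0.
  by apply/eqP => e; move/eqP: det1; rewrite e mul0r eq_sym oner_eq0.
(* y3' is orthogonal to x4' and x5', which span <x4, x5>. *)
have [y3y4 y3y5] : crd b (y_ 4) (b' (y_ 3)) = 0 /\ crd b (y_ 5) (b' (y_ 3)) = 0.
  have := formE (x_ 4) (y_ 3); have := formE (x_ 5) (y_ 3).
  rewrite !gen_codeE /= !subrr !form5 !big_ord_recl !big_ord0 x4E x5E /=.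
  set p := crd b (y_ 4) _; set q := crd b (y_ 5) _ => e5 e4.
  have e4' : m * p + n * q = 0 by rewrite -[RHS]e4; ring.
  have e5' : l * p + k * q = 0 by rewrite -[RHS]e5; ring.
  split; apply: (mulfI det0); rewrite mulr0.
    transitivity (k * (m * p + n * q) - n * (l * p + k * q)); first by ring.
    by rewrite e4' e5'; ring.
  transitivity (m * (l * p + k * q) - l * (m * p + n * q)); first by ring.
  by rewrite e4' e5'; ring.
pose t := crd b (x_ 2) (b' (x_ 2)); pose a := crd b (y_ 2) (b' (y_ 2)).
have ta : t * a = 1.
  transitivity (saa_form (b' (x_ 2)) (b' (y_ 2))); last first.
    by rewrite formE !gen_codeE /= subr0.
  rewrite form5 !big_ord_recl big_ord0 /=.
  rewrite x2x1 x2y1 x2y2 x2y3 x2y4 x2y5 y2y3 y2y4 y2y5.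
  by rewrite /t /a; ring.
have a0 : a != 0.
  by apply/eqP => e; move/eqP: ta; rewrite e mulr0 eq_sym oner_eq0.
pose al := crd b (x_ 1) (b' (x_ 1)); pose be := crd b (y_ 1) (b' (x_ 1)).
pose al' := crd b (x_ 1) (b' (y_ 1)); pose be' := crd b (y_ 1) (b' (y_ 1)).
have w1 : al * be' - be * al' = 1.
  transitivity (saa_form (b' (x_ 1)) (b' (y_ 1))); last first.
    by rewrite formE !gen_codeE /= subr0.
  rewrite form5 !big_ord_recl big_ord0 /=.
  rewrite x1y2 x1y3 x1y4 x1y5 y1y2 y1y3 y1y4 y1y5.
  by rewrite /al /al' /be /be'; ring.
pose d3 := crd b (y_ 3) (b' (y_ 3)); pose e2 := crd b (y_ 2) (b' (y_ 3)).
have x4c : (crd b (x_ 4) (b' (x_ 4)) = m) * (crd b (x_ 5) (b' (x_ 4)) = n).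
  by move: x4E; rewrite /coords => -[_ _ _ -> ->].
have x5c : (crd b (x_ 4) (b' (x_ 5)) = l) * (crd b (x_ 5) (b' (x_ 5)) = k).
  by move: x5E; rewrite /coords => -[_ _ _ -> ->].
have eqs g h i : crd b (x_ i) (saa_mul (b' g) (b' h)) =
  row_triple [:: gamma; 1; 0; r; s; 0; 0; 1; 1; 0; 0; 0; 0; 0; 0]
     (coords b (b' g)) (coords b (b' h))
     [seq (j == gen_code (y_ i))%N%:R | j <- iota 0 10].
  by rewrite crd_mul_x (triple_rows _ _ _ bF) cE (coords_basis _ bP).
exists a, k, l, (d3 / a), (e2 / a).
have [] := @parameters_of_change F r s r' s' a k l m n d3 e2 al be al' be' a0.
- have := eqs (x_ 1) (y_ 2) 4%N.
  rewrite (mul_x1y2 bG') scale1r x4c gen_codeE => ->.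
  rewrite /row_triple /row_minor /=.
  by rewrite x1y2 x1y3 x1y4 x1y5 y2y3 y2y4 y2y5 /al /a; ring.
- have := eqs (x_ 1) (y_ 2) 5%N.
  rewrite (mul_x1y2 bG') scale1r x4c gen_codeE => ->.
  rewrite /row_triple /row_minor /=.
  by rewrite x1y2 x1y3 x1y4 x1y5 y2y3 y2y4 y2y5 /be /a; ring.
- have := eqs (y_ 1) (y_ 2) 4%N.
  rewrite (mul_y1y2 bG') scale1r x5c gen_codeE => ->.
  rewrite /row_triple /row_minor /=.
  by rewrite y1y2 y1y3 y1y4 y1y5 y2y3 y2y4 y2y5 /al' /a; ring.
- have := eqs (y_ 1) (y_ 2) 5%N.
  rewrite (mul_y1y2 bG') scale1r x5c gen_codeE => ->.
  rewrite /row_triple /row_minor /=.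
  by rewrite y1y2 y1y3 y1y4 y1y5 y2y3 y2y4 y2y5 /be' /a; ring.
- exact: w1.
- have := eqs (y_ 1) (y_ 3) 4%N.
  rewrite (mul_y1y3 bG') scale1r x4c gen_codeE => ->.
  rewrite /row_triple /row_minor /=.
  by rewrite y1y2 y1y3 y1y4 y1y5 y3y4 y3y5 /al' /be' /d3 /e2; ring.
- have := eqs (y_ 1) (y_ 3) 5%N.
  rewrite (mul_y1y3 bG') scale1r x4c gen_codeE => ->.
  rewrite /row_triple /row_minor /=.
  by rewrite y1y2 y1y3 y1y4 y1y5 y3y4 y3y5 /al' /be' /d3 /e2; ring.
- have := eqs (x_ 1) (y_ 3) 4%N.
  rewrite (mul_x1y3 bG') crdD !crdZ x4c x5c gen_codeE => ->.
  rewrite /row_triple /row_minor /=.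
  by rewrite x1y2 x1y3 x1y4 x1y5 y3y4 y3y5 /al /be /d3 /e2; ring.
- have := eqs (x_ 1) (y_ 3) 5%N.
  rewrite (mul_x1y3 bG') crdD !crdZ x4c x5c gen_codeE => ->.
  rewrite /row_triple /row_minor /=.
  by rewrite x1y2 x1y3 x1y4 x1y5 y3y4 y3y5 /al /be /d3 /e2; ring.
move=> mkE GE rE sE; split=> //.
have -> : gamma' = t * gamma * (p4 * q5 - q4 * p5).
  case: cE' => <- _ _ _ _ _ _ _ _ _ _ _ _ _ _.
  rewrite (triple_rows _ _ _ bF) cE /row_triple /row_minor /=.
  rewrite x2x1 x2y1 x2y2 x2y3 x2y4 x2y5.
  by rewrite /t /p4 /q4 /p5 /q5; ring.
transitivity (gamma * (t * a) * (a ^+ 2 * (p4 * q5 - q4 * p5))); first by ring.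
by rewrite -mkE det1 ta !mulr1.
Qed.

Theorem proposition4p15 (F : fieldType) (charF2 : 2%N \in [pchar F]) :
  (forall L : saa F,
     nilpotent L ->
     \dim {:L} = 10%N ->
     isotropic (saa_center L) ->
     \dim (saa_center L) = 3%N ->
     \dim (lcs L 3) = 6%N ->
     saa_prod (lcs L 3) (lcs L 2) = lcs L 5 ->
     type_C_nonzero_linear_term L ->
     exists gamma r s : F,
       admissible gamma r s /\ has_presentation L (P10_3_9 gamma r s))
  /\
  (forall gamma r s gamma' r' s' : F,
     admissible gamma r s -> admissible gamma' r' s' ->
     forall L L' : saa F,
       has_presentation L (P10_3_9 gamma r s) ->
       has_presentation L' (P10_3_9 gamma' r' s') ->
       (saa_iso L' L <->
        [/\ nonzero_cube (gamma' / gamma),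
            Gset r s (r' / r) &
            Hset r' (s' - (r' / r) ^+ 2 * s)])).
Proof.
have two0 : 2 = 0 :> F := pcharf0 charF2.
split=> [L _ _ _ _ _|]; first exact: adapted_presentation.
move=> gamma r s gamma' r' s' [g0 r0 _] [g0' r0' _] L L'.
move=> /presentationE[b bG] LP'; split=> [iso | [[c c0 cE] [x [y [_ GE]]] [z HE]]].
  have dimL := standard_basis_dim (flag_standard bG.1).
  have /presentationE[b' bG'] := has_presentation_iso dimL iso LP'.
  have [a [k [l [d [e [a0 gE GE rE sE]]]]]] := compare_presentations bG bG' g0 g0'.
  have rd : r' = d * r by rewrite rE two0; ring.
  have dE : r' / r = d by rewrite rd mulfK.
  have d0 : d != 0 by apply/eqP => d0; move: r0'; rewrite rd d0 mul0r eqxx.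
  split; rewrite ?dE.
  - exists a^-1; first by rewrite invr_eq0.
    by rewrite -gE; field; rewrite a0 g0'.
  - exists (d * k / a), (d * l / a); split.
      have q0 t : d * t / a = 0 -> t = 0.
        by move/eqP; rewrite !mulf_eq0 invr_eq0 (negbTE d0) (negbTE a0) orbF => /eqP.
      apply/eqP => -[/q0 k0 /q0 l0].
      by case/eqP: (expf_neq0 2 a0); rewrite -GE k0 l0; ring.
    apply: (mulIf (expf_neq0 2 a0)).
    transitivity (d ^+ 2 * (k ^+ 2 + r * k * l - s * l ^+ 2)
                  + 2 * (d ^+ 2 * s * l ^+ 2)).
      by rewrite two0 -{1}GE; ring.
    by field; rewrite a0.
  - exists e; rewrite sE.
    transitivity (e ^+ 2 + r' * e - 2 * (e ^+ 2 + d * e * r)).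
      by rewrite rd; ring.
    by rewrite two0; ring.
have d0 : r' / r != 0 by rewrite mulf_neq0 ?invr_eq0.
set d := r' / r in d0 GE HE.
have Gk : (x / (c * d)) ^+ 2 + r * (x / (c * d)) * (y / (c * d))
    - s * (y / (c * d)) ^+ 2 = (c ^+ 2 * d)^-1.
  transitivity ((x ^+ 2 + r * x * y + s * y ^+ 2) / (c * d) ^+ 2
                - 2 * (s * (y / (c * d)) ^+ 2)).
    by field; rewrite c0 d0.
  by rewrite two0 -GE; field; rewrite c0 d0.
(* With a = 1 / c, d = r' / r and e = z, the pair (k, l) is a (x, y) / d. *)
have ci0 : c^-1 != 0 by rewrite invr_eq0.
have [|b'] :=
  rescale_presentation z bG ci0 (k := x / (c * d)) (l := y / (c * d)).
  by rewrite Gk invr_eq0 mulf_neq0 ?expf_neq0.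
rewrite Gk; have -> : c^-1 ^+ 2 / (c ^+ 2 * d)^-1 = d
  by rewrite invrK exprVn mulrA mulVf ?mul1r ?expf_neq0.
have -> : gamma / c^-1 ^+ 3 = gamma'.
  by rewrite exprVn invrK -cE mulrC divfK.
have -> : d * r + 2 * z = r' by rewrite two0 mul0r addr0 divfK.
have -> : d ^+ 2 * s - d * z * r - z ^+ 2 = s'.
  have -> : s' = d ^+ 2 * s + (z ^+ 2 + r' * z) by rewrite -HE; ring.
  have -> : r' = d * r by rewrite divfK.
  transitivity (d ^+ 2 * s + (z ^+ 2 + d * r * z) - 2 * (d * z * r + z ^+ 2)).
    by ring.
  by rewrite two0; ring.
move=> bG'; case/presentationE: LP' => b'' bG''.
exact: presenting_iso bG' bG''.
Qed.
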